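(* Let $n\ge 1$ and $N\ge 1$ be integers, let $L>0$, and for each $i\in\{1,\dots,n\}$ let $f_i:\mathbb{R}^N\to\mathbb{R}$ be a differentiable convex $L$-smooth function, so that $R_i:=\nabla f_i$ is $\frac1L$-cocoercive. Let $F=\frac1n\sum_{i=1}^n f_i$ and suppose that $X^\star=\operatorname{arg\,min}F=\{x\in\mathbb{R}^N: 0=\frac1n\sum_{i=1}^n\nabla f_i(x)\}$ is nonempty. Let $(x^k)_{k\in\mathbb{N}}$ and $(y_i^k)_{k\in\mathbb{N}}$, $i\in\{1,\dots,n\}$, be the random sequences generated by the SVAG algorithm (defined in the context) applied to $R_i=\nabla f_i$ with step-size $\lambda>0$, innovation weight $\theta\in[0,n]$ and given initial points $x^0,y_1^0,\dots,y_n^0\in\mathbb{R}^N$. Put $$c=2+(n-\theta)\frac{\theta-1}{n}\Big(\frac{\theta-1}{n}-1+\frac{\theta-1}{|\theta-1|}\sqrt2\Big),$$ where for $\theta=1$ the second summand is understood to be $0$, i.e. $c=2$. If $$\frac1L\cdot\frac1c>\lambda,$$ then there is a (random) solution $x^\star\in X^\star$ such that, almost surely, $x^k\to x^\star$ and $y_i^k\to\nabla f_i(x^\star)$ for all $i\in\{1,\dots,n\}$ as $k\to\infty$. Moreover, for all $i\in\{1,\dots,n\}$, all $t\in\mathbb{N}$ and any $x^\star\in X^\star$, $$\min_{k\in\{0,\dots,t\}}\mathbb{E}\big[\|\nabla f_i(x^k)-\nabla f_i(x^\star)\|^2\big]\le\frac{n}{\lambda(L^{-1}-\lambda c)}\,\frac1{t+1}\,(C_R+C_F),$$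 $$\min_{k\in\{0,\dots,t\}}\mathbb{E}\big[\|y_i^k-\nabla f_i(x^\star)\|^2\big]\le\frac{n}{\lambda(L^{-1}-\lambda c)}\,\frac1{t+1}\,(C_R+C_F),$$ $$\min_{k\in\{0,\dots,t\}}\mathbb{E}\big[F(x^k)-F(x^\star)\big]\le\frac{1}{\lambda(1-L\lambda c)}\,\frac1{t+1}\,(C_R+C_F),$$ where $$C_R=\min_{x\in X^\star}\Big\{\|x^0-x\|^2+\frac{\lambda}{L}\sum_{i=1}^n\|y_i^0-R_i x^\star\|^2+\lambda^2(n-\theta)^2\Big\|\frac1n\sum_{i=1}^n y_i^0\Big\|^2-2\lambda(n-\theta)\Big\langle x^0-x,\frac1n\sum_{i=1}^n y_i^0\Big\rangle\Big\},$$ $$C_F=2\lambda(n-\theta)\Big(F\Big(x^0+\frac{\lambda}{n}\sum_{i=1}^n y_i^0\Big)-F(x^\star)\Big).$$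
   Context: $\mathbb{N}=\{0,1,2,\dots\}$; $\langle\cdot,\cdot\rangle$ and $\|\cdot\|$ are the standard Euclidean inner product and norm. An operator $R:\mathbb{R}^N\to\mathbb{R}^N$ is $\frac1L$-cocoercive if $\langle Rx-Ry,x-y\rangle\ge\frac1L\|Rx-Ry\|^2$ for all $x,y\in\mathbb{R}^N$. A differentiable convex function $f:\mathbb{R}^N\to\mathbb{R}$ is $L$-smooth if $\nabla f$ is $\frac1L$-cocoercive (equivalently, $\nabla f$ is $L$-Lipschitz). Under the assumptions, $R_i x^\star=\nabla f_i(x^\star)$ takes the same value for every $x^\star\in X^\star$. SVAG algorithm: given operators $R_1,\dots,R_n:\mathbb{R}^N\to\mathbb{R}^N$, deterministic initial points $x^0,y_1^0,\dots,y_n^0\in\mathbb{R}^N$, step-size $\lambda>0$ and innovation weight $\theta\in\mathbb{R}$, for $k=0,1,\dots$: sample $i^k$ uniformly from $\{1,\dots,n\}$, independently of the past (i.e. $i^k$ is independent of a $\sigma$-algebra $\mathcal{F}_k$, with $\mathcal{F}_0\subset\mathcal{F}_1\subset\cdots$, for which the iterates $x^k,y_1^k,\dots,y_n^k$ are measurable), and set $$x^{k+1}=x^k-\lambda\Big(\frac{\theta}{n}\big(R_{i^k}x^k-y_{i^k}^k\big)+\frac1n\sum_{j=1}^n y_j^k\Big),\qquad y_{i^k}^{k+1}=R_{i^k}x^k,\qquad y_j^{k+1}=y_j^k\ \text{ for all } j\ne i^k.$$ *)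

(* Defs.v *)
From HB Require Import structures.
From mathcomp Require Import all_boot all_order all_algebra.
From mathcomp Require Import all_classical all_reals all_analysis.

Set Implicit Arguments.
Unset Strict Implicit.
Unset Printing Implicit Defensive.

Import Order.TTheory GRing.Theory Num.Theory.
Import numFieldNormedType.Exports.

Local Open Scope classical_set_scope.
Local Open Scope ring_scope.

Section Euclidean.
Context {R : realType} {N : nat}.
Implicit Types (x y : 'rV[R]_N) (f : 'rV[R]_N -> R).

Definition dotp x y : R := \sum_(j < N) x ord0 j * y ord0 j.

(* The library's norm on matrices is the sup norm, hence this one. It induces
   the same topology, so the library's convergence can be used as is. *)
Definition enorm x : R := Num.sqrt (dotp x x).

Definition gradient f x : 'rV[R]_N := \row_j 'D_(delta_mx ord0 j) f x.

Definition cocoercive (b : R) (A : 'rV[R]_N -> 'rV[R]_N) : Prop :=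
  forall x y, b * enorm (A x - A y) ^+ 2 <= dotp (A x - A y) (x - y).

Definition convex_smooth (L : R) f : Prop :=
  [/\ forall x, differentiable f x,
      convex_function [set: 'rV[R]_N] f &
      cocoercive L^-1 (gradient f)].

Definition argmin f : set 'rV[R]_N := [set x | forall z, f x <= f z].

End Euclidean.

Definition is_min {R : realType} (A : set R) (m : R) : Prop :=
  A m /\ lbound A m.

Section Svag.
Context {R : realType} {n N : nat}.
Implicit Types (Rop : 'I_n -> 'rV[R]_N -> 'rV[R]_N) (y : 'I_n -> 'rV[R]_N).

Definition average (g : 'I_n -> 'rV[R]_N -> R) (x : 'rV[R]_N) : R :=
  n%:R^-1 * \sum_(i < n) g i x.

Definition svag_step Rop (lambda theta : R) (i : 'I_n)
    (s : 'rV[R]_N * ('I_n -> 'rV[R]_N)) : 'rV[R]_N * ('I_n -> 'rV[R]_N) :=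
  let: (x, y) := s in
  (x - lambda *: ((theta / n%:R) *: (Rop i x - y i)
                  + n%:R^-1 *: \sum_(j < n) y j),
   fun j => if j == i then Rop i x else y j).

Fixpoint svag Rop (lambda theta : R) (x0 : 'rV[R]_N) y0 (i : nat -> 'I_n)
    (k : nat) : 'rV[R]_N * ('I_n -> 'rV[R]_N) :=
  if k is k'.+1 then
    svag_step Rop lambda theta (i k') (svag Rop lambda theta x0 y0 i k')
  else (x0, y0).

(* For theta = 1 the quotient is 0 / 0 = 0 and the factor theta - 1 makes the
   second summand vanish, so that svag_const = 2. *)
Definition svag_const (theta : R) : R :=
  2 + (n%:R - theta) * ((theta - 1) / n%:R)
      * ((theta - 1) / n%:R - 1 + (theta - 1) / `|theta - 1| * Num.sqrt 2).

End Svag.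
Arguments svag_const {R} n theta.

Section Probability.
Context {R : realType} {d : measure_display} {T : measurableType d}.
Context {n N : nat}.

(* Measurability of a random vector with respect to a sigma-algebra G on T; the
   Borel sigma-algebra of R^N is generated by the coordinate maps. *)
Definition measurable_vec (G : set (set T)) (X : T -> 'rV[R]_N) : Prop :=
  forall (j : 'I_N) (B : set R), measurable B ->
    G ((fun w => X w ord0 j) @^-1` B).

Definition filtration (G : nat -> set (set T)) : Prop :=
  [/\ forall k, sigma_algebra [set: T] (G k),
      forall k, G k `<=` measurable &
      forall k, G k `<=` G k.+1].

(* The k-th sample is a uniform random variable, independent of G k. *)
Definition uniform_sampling (P : probability T R) (G : nat -> set (set T))
    (i : nat -> T -> 'I_n) : Prop :=
  forall k (j : 'I_n),
    [/\ measurable (i k @^-1` [set j]),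
        P (i k @^-1` [set j]) = (n%:R^-1)%:E &
        forall A, G k A ->
          P (A `&` i k @^-1` [set j]) = (P A * P (i k @^-1` [set j]))%E].

End Probability.

Section Constants.
Context {R : realType} {n N : nat}.
Variables (f : 'I_n -> 'rV[R]_N -> R) (L lambda theta : R).
Variables (x0 : 'rV[R]_N) (y0 : 'I_n -> 'rV[R]_N).

Let ybar : 'rV[R]_N := n%:R^-1 *: \sum_(i < n) y0 i.

(* The function of x minimized over argmin F in the definition of C_R. *)
Definition CR_fun (xstar x : 'rV[R]_N) : R :=
  enorm (x0 - x) ^+ 2
  + lambda / L * \sum_(i < n) enorm (y0 i - gradient (f i) xstar) ^+ 2
  + lambda ^+ 2 * (n%:R - theta) ^+ 2 * enorm ybar ^+ 2
  - 2 * lambda * (n%:R - theta) * dotp (x0 - x) ybar.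

Definition CF (xstar : 'rV[R]_N) : R :=
  2 * lambda * (n%:R - theta)
  * (average f (x0 + (lambda / n%:R) *: \sum_(i < n) y0 i) - average f xstar).

End Constants.

(* Main.v *)
Require Import Defs.
From HB Require Import structures.
From mathcomp Require Import all_boot all_order all_algebra.
From mathcomp Require Import all_classical all_reals all_analysis.
From mathcomp Require Import measurable_realfun ring lra.

Set Implicit Arguments.
Unset Strict Implicit.
Unset Printing Implicit Defensive.

Import Order.TTheory GRing.Theory Num.Theory.
Import numFieldNormedType.Exports.

Local Open Scope classical_set_scope.
Local Open Scope ring_scope.

(** Write [m = n - theta], [ybar] for the mean of the memory [y_1, .., y_n] and,
   for a minimizer [z] of the average [F],
     [a_i = grad f_i(x) - grad f_i(z)],   [b_i = y_i - grad f_i(z)].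
   Since the gradients at [z] sum to 0, [a_i] and [b_i] have means [grad F(x)]
   and [ybar] over a uniform index [i].

   The step of the algorithm is biased in [x], but the point
   [u = x - lambda m ybar] moves by [- lambda (ybar + grad f_i(x) - y_i)], whose
   mean is the gradient step [- lambda grad F(x)].  The price for using [u] is
   the cross term [2 lambda^2 m <grad F(x), ybar>] in the mean change of
   [|u - z|^2].  It cancels against the mean change of
   [2 lambda m F(x + lambda ybar)]: convexity bounds the old value of
   [F(x + lambda ybar)] below by [F(x) + lambda <grad F(x), ybar>], while the
   new point is [x - (lambda (theta - 1) / n) (grad f_i(x) - y_i)], so that the
   descent lemma bounds the mean of the new value.  Therefore
     [V_z = |u - z|^2 + (lambda / L) sum_i |b_i|^2
            + 2 lambda m (F(x + lambda ybar) - F(z))]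
   decreases in mean at every step by at least
     [lambda (1 / L - lambda c) (1 / n) sum_i (|a_i|^2 + |b_i|^2)]
   (lemma [lyapunov_drift]), and also by at least
   [lambda (1 - L lambda c) (F(x) - F(z))] (lemma [lyapunov_drift_value]).  In
   the constant [c], the 2 bounds the second moment of [ybar + a_i - b_i] and the
   rest collects the error terms of the change of [F(x + lambda ybar)]; the
   square root of 2 comes from the eigenvalue in [quadratic_form_le].

   Rates.  [C_R + C_F] is the initial value of [V_p] for the minimizer [p]
   nearest to the initial [u], so summing the expected decreases and comparing a
   minimum with a mean gives the three bounds.

   Almost sure convergence.  Each [V_z] is a nonnegative supermartingale along
   the algorithm, hence converges almost surely ([supermartingale_ae_cvg], proved
   by counting upcrossings), and the decreases, being summable in mean, force
   [a_i], [b_i] and [F(x) - F(z)] to 0.  For almost every trajectory this holds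
   simultaneously for all [z] in a countable dense set of minimizers; then
   [|u - z|] converges for these [z], every cluster point of [u] is a minimizer,
   and Opial's lemma gives a limit.

   After k steps the state takes finitely many values, so each random variable
   below factors through a finite partition into events of the k-th
   sigma-algebra ([finite_over]).  This settles measurability and integrability
   for arbitrary functions of the state, and reduces conditioning on the past to
   the product formula for the k-th sample and one such event. *)

(** * Euclidean geometry *)

Section EuclideanTheory.
Context {R : realType} {N : nat}.
Implicit Types (x y z v : 'rV[R]_N) (a : R).

Lemma dotpC x y : dotp x y = dotp y x.
Proof. by apply: eq_bigr => j _; rewrite mulrC. Qed.

Lemma dotpDl x y z : dotp (x + y) z = dotp x z + dotp y z.
Proof. by rewrite /dotp -big_split; apply: eq_bigr => j _; rewrite mxE mulrDl. Qed.

Lemma dotpZl a x y : dotp (a *: x) y = a * dotp x y.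
Proof. by rewrite /dotp mulr_sumr; apply: eq_bigr => j _; rewrite mxE mulrA. Qed.

Lemma dotpNl x y : dotp (- x) y = - dotp x y.
Proof. by rewrite -scaleN1r dotpZl mulN1r. Qed.

Lemma dotpDr x y z : dotp x (y + z) = dotp x y + dotp x z.
Proof. by rewrite dotpC dotpDl !(dotpC _ x). Qed.

Lemma dotpZr a x y : dotp x (a *: y) = a * dotp x y.
Proof. by rewrite dotpC dotpZl dotpC. Qed.

Lemma dotpNr x y : dotp x (- y) = - dotp x y.
Proof. by rewrite dotpC dotpNl dotpC. Qed.

Definition dotpE := (dotpDl, dotpDr, dotpNl, dotpNr, dotpZl, dotpZr).

Lemma dotp0l x : dotp 0 x = 0.
Proof. by rewrite -(scale0r 0) dotpZl mul0r. Qed.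

Lemma dotp_suml (I : finType) (g : I -> 'rV[R]_N) x :
  dotp (\sum_i g i) x = \sum_i dotp (g i) x.
Proof.
apply: (big_ind2 (fun u a => dotp u x = a)) => //; first exact: dotp0l.
by move=> u a v b <- <-; rewrite dotpDl.
Qed.

Lemma dotp_ge0 x : 0 <= dotp x x.
Proof. by apply: sumr_ge0 => j _; rewrite -expr2 sqr_ge0. Qed.

Lemma enorm_sqr x : enorm x ^+ 2 = dotp x x.
Proof. by rewrite sqr_sqrtr// dotp_ge0. Qed.

Lemma enorm_ge0 x : 0 <= enorm x.
Proof. exact: sqrtr_ge0. Qed.

Lemma sqr_coord_le x j : x ord0 j ^+ 2 <= dotp x x.
Proof.
rewrite /dotp (bigD1 j)//= -expr2 lerDl.
by apply: sumr_ge0 => i _; rewrite -expr2 sqr_ge0.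
Qed.

Lemma dotp_eq0 x : dotp x x = 0 -> x = 0.
Proof.
move=> x0; apply/rowP => j; rewrite mxE; apply/eqP.
by rewrite -sqrf_eq0 eq_le sqr_ge0 andbT -x0 sqr_coord_le.
Qed.

Lemma dotp_young a x y : 0 < a -> 2 * dotp x y <= a * dotp x x + a^-1 * dotp y y.
Proof.
move=> a0; have := dotp_ge0 (a *: x - y); rewrite !dotpE (dotpC y x) => h.
have -> : a * dotp x x + a^-1 * dotp y y = 2 * dotp x y
    + a^-1 * (a * (a * dotp x x) - a * dotp x y - (a * dotp x y - dotp y y)).
  by field; rewrite gt_eqF.
by rewrite lerDl mulr_ge0 ?invr_ge0 ?(ltW a0)//; move: h; lra.
Qed.

(** The squared norm of [|x|^2 y - <x, y> x] is [|x|^2] times the difference of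
   the two sides. *)
Lemma dotp_CS x y : dotp x y ^+ 2 <= dotp x x * dotp y y.
Proof.
have [x0|/eqP x0] := eqVneq (dotp x x) 0.
  by rewrite (dotp_eq0 x0) !dotp0l mul0r expr0n.
have xx0 : 0 < dotp x x by rewrite lt_def dotp_ge0 andbT; exact/eqP.
have := dotp_ge0 (dotp x x *: y - dotp x y *: x).
rewrite !dotpE (dotpC y x) => h.
by rewrite -subr_ge0 -(pmulr_rge0 _ xx0); lra.
Qed.

Lemma dotp_le_enorm x y : dotp x y <= enorm x * enorm y.
Proof.
rewrite -sqrtrM ?dotp_ge0//; apply: (le_trans (ler_norm _)).
by rewrite -sqrtr_sqr ler_sqrt ?dotp_CS// mulr_ge0 ?dotp_ge0.
Qed.

Lemma enormD x y : enorm (x + y) <= enorm x + enorm y.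
Proof.
rewrite -(@ler_pXn2r _ 2)// ?nnegrE ?addr_ge0 ?enorm_ge0//.
rewrite sqrrD !enorm_sqr !dotpE (dotpC y x).
by have := dotp_le_enorm x y; rewrite mulr2n; lra.
Qed.

Lemma enormN x : enorm (- x) = enorm x.
Proof. by rewrite /enorm dotpNl dotpNr opprK. Qed.

Lemma norm_coord_le x j : `|x ord0 j| <= enorm x.
Proof. by rewrite -sqrtr_sqr ler_sqrt ?dotp_ge0 ?sqr_coord_le. Qed.

Lemma mxnorm_coord_le x j : `|x ord0 j| <= `|x|.
Proof.
rewrite [leRHS]/Num.norm/= mx_normrE.
by apply: (le_trans _ (le_bigmax _ _ (ord0, j))).
Qed.

Lemma mxnorm_le_enorm x : `|x| <= enorm x.
Proof.
rewrite [leLHS]/Num.norm/= mx_normrE; apply/bigmax_leP; split.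
  exact: enorm_ge0.
by move=> [i j] _ /=; rewrite (ord1 i) norm_coord_le.
Qed.

Lemma dotp_le_mxnorm x : dotp x x <= N%:R * `|x| ^+ 2.
Proof.
rewrite mulr_natl -[X in _ *+ X]card_ord -sumr_const; apply: ler_sum => j _.
by rewrite -expr2 -real_normK ?num_real// lerXn2r ?nnegrE// mxnorm_coord_le.
Qed.

End EuclideanTheory.

Section Averages.
Context {R : realType} {n : nat}.
Implicit Types (a b : 'I_n -> R).

Definition mean a : R := n%:R^-1 * \sum_i a i.

Lemma meanD a b : mean (fun i => a i + b i) = mean a + mean b.
Proof. by rewrite /mean big_split mulrDr. Qed.

Lemma meanZ c a : mean (fun i => c * a i) = c * mean a.
Proof. by rewrite /mean -mulr_sumr mulrCA. Qed.

Lemma meanN a : mean (fun i => - a i) = - mean a.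
Proof. by rewrite /mean sumrN mulrN. Qed.

Lemma meanB a b : mean (fun i => a i - b i) = mean a - mean b.
Proof. by rewrite meanD meanN. Qed.

Lemma mean_cst c : (0 < n)%N -> mean (fun=> c) = c.
Proof.
move=> n0; rewrite /mean sumr_const card_ord -[c *+ n]mulr_natl mulrA mulVf ?mul1r//.
by rewrite pnatr_eq0 -lt0n.
Qed.

Lemma eq_mean a b : a =1 b -> mean a = mean b.
Proof. by move=> ab; rewrite /mean (eq_bigr b). Qed.

Lemma ler_mean a b : (forall i, a i <= b i) -> mean a <= mean b.
Proof. by move=> ab; rewrite ler_wpM2l ?invr_ge0// ler_sum. Qed.

Lemma mean_ge0 a : (forall i, 0 <= a i) -> 0 <= mean a.
Proof. by move=> a0; rewrite mulr_ge0 ?invr_ge0// sumr_ge0. Qed.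

Lemma le_mean_term a i : (forall i, 0 <= a i) -> n%:R^-1 * a i <= mean a.
Proof.
move=> a0; rewrite ler_wpM2l ?invr_ge0// (bigD1 i)//= lerDl.
by apply: sumr_ge0 => j _.
Qed.

Section VectorMean.
Context {N : nat}.
Implicit Types (p q : 'I_n -> 'rV[R]_N).

Definition vmean p : 'rV[R]_N := n%:R^-1 *: \sum_i p i.

Lemma vmeanB p q : vmean (fun i => p i - q i) = vmean p - vmean q.
Proof. by rewrite /vmean sumrB scalerBr. Qed.

Lemma mean_dotpl p x : mean (fun i => dotp (p i) x) = dotp (vmean p) x.
Proof. by rewrite /mean -dotp_suml dotpZl. Qed.

Lemma mean_dotpr p x : mean (fun i => dotp x (p i)) = dotp x (vmean p).
Proof. by rewrite dotpC -mean_dotpl; apply: eq_mean => i; rewrite dotpC. Qed.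

(** Second moment of a shifted random vector; with [c] minus the mean it yields
   Jensen's inequality [sqr_vmean_le]. *)
Lemma mean_sqrDl c p : (0 < n)%N ->
  mean (fun i => dotp (c + p i) (c + p i)) =
  dotp c c + 2 * dotp c (vmean p) + mean (fun i => dotp (p i) (p i)).
Proof.
move=> n0; rewrite -mean_dotpr -{1}(mean_cst (dotp c c) n0) -meanZ -!meanD.
by apply: eq_mean => i; rewrite !dotpE (dotpC (p i) c); ring.
Qed.

Lemma sqr_vmean_le p : (0 < n)%N ->
  dotp (vmean p) (vmean p) <= mean (fun i => dotp (p i) (p i)).
Proof.
move=> n0; rewrite -subr_ge0.
have : 0 <= mean (fun i => dotp (- vmean p + p i) (- vmean p + p i)).
  by apply: mean_ge0 => i; exact: dotp_ge0.
by rewrite mean_sqrDl// !dotpE; lra.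
Qed.

End VectorMean.
End Averages.

(** * Smooth convex functions *)

Section Smooth.
Context {R : realType} {N : nat}.
Implicit Types (x y z v : 'rV[R]_N) (f : 'rV[R]_N -> R).

Lemma derive_dotp f x v : differentiable f x -> 'D_v f x = dotp (gradient f x) v.
Proof.
move=> df; rewrite deriveE// {1}(matrix_sum_delta v) big_ord1 linear_sum.
apply: eq_bigr => j _; rewrite linearZ/= mxE deriveE// mulrC.
by congr (_ * _); rewrite !mxE.
Qed.

Lemma is_derive_line f x v t : differentiable f (x + t *: v) ->
  is_derive t (1 : R) (fun s : R => f (x + s *: v)) (dotp (gradient f (x + t *: v)) v).
Proof.
move=> df; have dv : derivable f (x + t *: v) v by exact: diff_derivable.
have E : (fun h : R => h^-1 *: (f (x + (h *: 1 + t) *: v) - f (x + t *: v)))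
     = (fun h : R => h^-1 *: (f (h *: v + (x + t *: v)) - f (x + t *: v))).
  apply/funext => h; congr (_ *: (f _ - _)).
  by rewrite scalerDl [h *: 1]mulr1 addrCA.
split; first by rewrite /derivable/= E; exact: dv.
by rewrite -derive_dotp// /derive/= E.
Qed.

(** The mean value theorem on the segment is the only access to the values of f:
   both the gradient inequality and the descent lemma are drawn from it. *)
Lemma gradient_mvt f x v : (forall y, differentiable f y) ->
  exists2 c, 0 <= c <= 1 & f (x + v) - f x = dotp (gradient f (x + c *: v)) v.
Proof.
move=> df.
have [||c] := @MVT_segment R (fun s : R => f (x + s *: v))
  (fun s : R => dotp (gradient f (x + s *: v)) v) 0 1 ler01.
- by move=> s _; exact: is_derive_line.
- apply: continuous_subspaceT => s.
  apply/differentiable_continuous/derivable1_diffP.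
  by case: (is_derive_line (df (x + s *: v))).
- rewrite in_itv/= => c01; rewrite scale1r scale0r addr0 subr0 mulr1 => ->.
  by exists c.
Qed.

Variables (L : R) (f : 'rV[R]_N -> R).
Hypotheses (L0 : 0 < L) (df : forall x, differentiable f x)
  (cf : cocoercive L^-1 (gradient f)).

Lemma cocoerciveE x y :
  dotp (gradient f x - gradient f y) (gradient f x - gradient f y)
  <= L * dotp (gradient f x - gradient f y) (x - y).
Proof. by have := cf x y; rewrite enorm_sqr ler_pdivrMl. Qed.

(** A cocoercive gradient is monotone, so the slope at the intermediate point of
   the mean value theorem is at least the slope at [x]. *)
Lemma gradient_ineq x v : f x + dotp (gradient f x) v <= f (x + v).
Proof.
have [c /andP[c0 _] E] := gradient_mvt x v df.
suff : dotp (gradient f x) v <= dotp (gradient f (x + c *: v)) v by rewrite -E; lra.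
have [->|cN0] := eqVneq c 0; first by rewrite scale0r addr0.
have c_gt0 : 0 < c by rewrite lt_def cN0.
have := le_trans (dotp_ge0 _) (cocoerciveE (x + c *: v) x).
rewrite addrAC subrr add0r pmulr_rge0// dotpZr pmulr_rge0// !dotpE; lra.
Qed.

(** Young's inequality with weight [1 / (L c)] turns cocoercivity into the
   Lipschitz bound along the segment without taking square roots. *)
Lemma gradient_segment_le x v c : 0 <= c ->
  dotp (gradient f (x + c *: v) - gradient f x) v <= L * c * dotp v v.
Proof.
rewrite le_eqVlt => /predU1P[<-|c0].
  by rewrite scale0r addr0 subrr dotp0l mulr0 mul0r.
have := cocoerciveE (x + c *: v) x; rewrite addrAC subrr add0r.
set D := gradient _ _ - _; rewrite dotpZr => h.
have Lc0 : 0 < L * c by rewrite mulr_gt0.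
have := @dotp_young _ _ (L * c)^-1 D v; rewrite invr_gt0 invrK => /(_ Lc0) young.
have : (L * c)^-1 * dotp D D <= dotp D v by rewrite ler_pdivrMl// -mulrA.
lra.
Qed.

(** Subtracting from f its first order expansion at x and the parabola
   [L t^2 |v|^2 / 2] leaves a function of t with nonpositive derivative. *)
Lemma descent_lemma x v :
  f (x + v) <= f x + dotp (gradient f x) v + L / 2 * dotp v v.
Proof.
pose q := dotp v v; pose p := dotp (gradient f x) v.
pose g := fun t : R => f (x + t *: v) - (p * t + L / 2 * q * t ^+ 2).
have dg t : is_derive t (1 : R) g
    (dotp (gradient f (x + t *: v)) v - (p + L * t * q)).
  have := is_derive_line (df (x + t *: v)) => dline.
  have dq : is_derive t (1 : R) (fun t : R => p * t + L / 2 * q * t ^+ 2)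
     (p + L * t * q).
    by apply: is_derive_eq; rewrite /GRing.scale/=; field.
  exact: is_deriveB.
have [|c] := @MVT_segment R g _ 0 1 ler01 (fun t _ => dg t).
  apply: continuous_subspaceT => s.
  by apply/differentiable_continuous/derivable1_diffP; case: (dg s).
rewrite in_itv/= => /andP[c0 _].
have := gradient_segment_le x v c0; rewrite dotpDl dotpNl -/p -/q.
rewrite /g scale1r scale0r addr0 -/q -/p; lra.
Qed.

End Smooth.

(** * Averages of smooth convex functions *)

Section SmoothAverage.
Context {R : realType} {n N : nat}.
Implicit Types (x y z v : 'rV[R]_N).
Variables (L : R) (f : 'I_n -> 'rV[R]_N -> R).
Hypotheses (n0 : (0 < n)%N) (L0 : 0 < L) (hf : forall i, convex_smooth L (f i)).

Definition mean_gradient x : 'rV[R]_N := vmean (fun i => gradient (f i) x).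

Let df i x : differentiable (f i) x. Proof. by case: (hf i). Qed.
Let cf i : cocoercive L^-1 (gradient (f i)). Proof. by case: (hf i). Qed.

Lemma averageE x : average f x = mean (fun i => f i x).
Proof. by []. Qed.

Lemma average_gradient_ineq x v :
  average f x + dotp (mean_gradient x) v <= average f (x + v).
Proof.
rewrite !averageE -mean_dotpl -meanD; apply: ler_mean => i.
exact: gradient_ineq (cf i) _ _.
Qed.

Lemma average_descent x v :
  average f (x + v) <= average f x + dotp (mean_gradient x) v + L / 2 * dotp v v.
Proof.
rewrite !averageE -mean_dotpl -meanD -[X in _ <= _ + X](mean_cst _ n0) -meanD.
by apply: ler_mean => i; exact: descent_lemma (cf i) _ _.
Qed.

Lemma continuous_average : continuous (average f).
Proof.
move=> x; apply: (@cvgMl_tmp _ _ (nbhs x) _ (fun y => \sum_(i < n) f i y)).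
apply: (@cvg_big _ _ +%R) => [|i _]; first exact: add_continuous.
exact: differentiable_continuous.
Qed.

(** A gradient step of length [1 / L] decreases the average by at least
   [|mean_gradient z|^2 / (2 L)]. *)
Lemma argmin_mean_gradient z : argmin (average f) z -> mean_gradient z = 0.
Proof.
move=> zmin; apply: dotp_eq0; apply/eqP; rewrite eq_le dotp_ge0 andbT.
have := average_descent z (- L^-1 *: mean_gradient z).
have := zmin (z + - L^-1 *: mean_gradient z).
move: (mean_gradient z) => g; rewrite !dotpE; set q := dotp g g => h1 h2.
have Li : L * L^-1 = 1 by rewrite divff// gt_eqF.
have Li0 : 0 < L^-1 by rewrite invr_gt0.
rewrite -(pmulr_rle0 _ Li0); set l := L^-1 in Li Li0 h1 h2 *.
have E : L * l * l * q = l * q by rewrite Li mul1r.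
lra.
Qed.

Lemma mean_cocoercive x z :
  mean (fun i => dotp (gradient (f i) x - gradient (f i) z)
                      (gradient (f i) x - gradient (f i) z))
  <= L * dotp (mean_gradient x - mean_gradient z) (x - z).
Proof.
rewrite -vmeanB -mean_dotpl -meanZ; apply: ler_mean => i.
exact: cocoerciveE (cf i) _ _.
Qed.

(** Both mean gradients vanish, so cocoercivity leaves a sum of squares that is
   at most 0. *)
Lemma argmin_gradient_eq z z' i : argmin (average f) z -> argmin (average f) z' ->
  gradient (f i) z = gradient (f i) z'.
Proof.
move=> /argmin_mean_gradient Az /argmin_mean_gradient Az'.
have := mean_cocoercive z z'; rewrite Az Az' subrr dotp0l mulr0 => h.
apply/eqP; rewrite -subr_eq0; apply/eqP/dotp_eq0/eqP.
rewrite eq_le dotp_ge0 andbT.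
have ni : 0 < n%:R^-1 :> R by rewrite invr_gt0 ltr0n.
rewrite -(pmulr_rle0 _ ni); apply: le_trans h.
by apply: le_mean_term => j; exact: dotp_ge0.
Qed.

Lemma argmin_average_eq z z' : argmin (average f) z -> argmin (average f) z' ->
  average f z = average f z'.
Proof. by move=> h h'; apply/eqP; rewrite eq_le h h'. Qed.

End SmoothAverage.

(** * The Lyapunov function of the algorithm *)

Section SvagConst.
Context {R : realType}.
Variables (n : nat) (theta : R).
Hypotheses (n0 : (0 < n)%N) (htheta : theta <= n%:R).

Let tau := (theta - 1) / n%:R.

(** The quotient by the absolute value in the definition is a sign: absorbing it
   exhibits both contributions as nonnegative. *)
Lemma svag_constE : svag_const n theta =
  2 + (n%:R - theta) * (tau ^+ 2 + (Num.sqrt 2 * `|tau| - tau)).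
Proof.
have nn : 0 < n%:R :> R by rewrite ltr0n.
have E : tau * ((theta - 1) / `|theta - 1|) = `|tau|.
  rewrite /tau normrM normfV (gtr0_norm nn).
  have [d0|d0|->] := ltrgt0P (theta - 1); last by rewrite !mul0r.
    by rewrite divff ?mulr1 // gt_eqF.
  by rewrite invrN mulrN divff ?lt_eqF// mulrN1 mulNr.
rewrite /svag_const -/tau -E; set q := (theta - 1) / _; ring.
Qed.

Lemma svag_kappa_ge0 : 0 <= Num.sqrt 2 * `|tau| - tau.
Proof.
have s1 : 1 <= Num.sqrt 2 :> R by rewrite -[leLHS]sqrtr1 ler_sqrt// ler1n.
have := ler_norm tau; have := normr_ge0 tau; nra.
Qed.

Lemma svag_const_ge2 : 2 <= svag_const n theta.
Proof.
rewrite svag_constE lerDl mulr_ge0 ?subr_ge0// addr_ge0 ?sqr_ge0 ?svag_kappa_ge0//.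
Qed.

(** The largest eigenvalue of the quadratic form [t (2 <a, b> - 2 |a|^2)] is
   [sqrt 2 |t| - t]. *)
Lemma quadratic_form_le {N : nat} (t : R) (a b : 'rV[R]_N) :
  - (2 * t) * dotp a (a - b)
  <= (Num.sqrt 2 * `|t| - t) * (dotp a a + dotp b b).
Proof.
set s := Num.sqrt 2; have s2 : s ^+ 2 = 2 by rewrite sqr_sqrtr.
have s1 : 1 < s by rewrite -[ltLHS]sqrtr1 ltr_sqrt// ltr1n.
(* Young's inequality is applied with the weights s + 1 and s - 1, which are
   inverse to each other because s^2 = 2. *)
have sV : (s + 1)^-1 = s - 1.
  have sN0 : s + 1 != 0 by rewrite gt_eqF//; lra.
  by apply: (mulfI sN0); rewrite divff//; move: s2; lra.
have sp : 0 < s + 1 by lra.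
have sm : 0 < s - 1 by lra.
have young1 := dotp_young a b sp; rewrite sV in young1.
have young2 := dotp_young a (- b) sm; rewrite -sV invrK sV !dotpE opprK in young2.
rewrite !dotpE; have [t0|t0] := ger0P t.
  have := ler_wpM2l t0 young1; lra.
have tn : 0 <= - t by lra.
have := ler_wpM2l tn young2; lra.
Qed.

End SvagConst.

Section Drift.
Context {R : realType} {n N : nat}.
Variables (L lambda theta : R) (f : 'I_n -> 'rV[R]_N -> R).
Hypotheses (n0 : (0 < n)%N) (L0 : 0 < L) (hf : forall i, convex_smooth L (f i)).
Hypotheses (lambda0 : 0 < lambda) (htheta : theta <= n%:R)
  (hstep : lambda * L * svag_const n theta < 1).

Let state := ('rV[R]_N * ('I_n -> 'rV[R]_N))%type.
Let next := svag_step (fun i => gradient (f i)) lambda theta.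
Let tau := (theta - 1) / n%:R.
Let m := n%:R - theta.
Let c := svag_const n theta.
Let F := average f.
Let g i x := gradient (f i) x.

(** The step of the algorithm is biased unless [theta = n], but on this point
   it acts as an unbiased gradient step. *)
Definition shifted_point (s : state) : 'rV[R]_N :=
  s.1 - (lambda * m) *: vmean s.2.

(** The value of F at this point enters the Lyapunov function. Its next position
   differs from the current iterate only by a multiple of the innovation. *)
Definition probe_point (s : state) : 'rV[R]_N := s.1 + lambda *: vmean s.2.

Definition memory_error (z : 'rV[R]_N) (s : state) : R :=
  \sum_i dotp (s.2 i - g i z) (s.2 i - g i z).

Definition gradient_error (z : 'rV[R]_N) (s : state) : R :=
  \sum_i dotp (g i s.1 - g i z) (g i s.1 - g i z).

Definition lyapunov (z : 'rV[R]_N) (s : state) : R :=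
  dotp (shifted_point s - z) (shifted_point s - z)
  + lambda / L * memory_error z s
  + 2 * lambda * m * (F (probe_point s) - F z).

Let nn : 0 < n%:R :> R. Proof. by rewrite ltr0n. Qed.
Let nN0 : n%:R != 0 :> R. Proof. by rewrite gt_eqF. Qed.
Let m0 : 0 <= m. Proof. by rewrite subr_ge0. Qed.

Lemma lyapunov_ge0 z s : argmin F z -> 0 <= lyapunov z s.
Proof.
move=> zmin; apply: addr_ge0; first apply: addr_ge0.
- exact: dotp_ge0.
- apply: mulr_ge0; first by rewrite divr_ge0// ltW.
  by apply: sumr_ge0 => i _; exact: dotp_ge0.
- by rewrite !mulr_ge0// ?(ltW lambda0)// subr_ge0.
Qed.

Section OneStep.
Variables (x : 'rV[R]_N) (y : 'I_n -> 'rV[R]_N).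

Lemma vmean_update j v :
  vmean (fun i => if i == j then v else y i) = vmean y + n%:R^-1 *: (v - y j).
Proof.
rewrite /vmean -scalerDr; congr (_ *: _).
rewrite (bigD1 j)//= eqxx [in RHS](bigD1 j)//= addrC [y j + _]addrC -!addrA.
rewrite [y j + _]addrC subrK; congr (_ + _).
by apply: eq_bigr => i /negPf ->.
Qed.

Lemma shifted_point_next j : shifted_point (next j (x, y)) =
  shifted_point (x, y) + - lambda *: (vmean y + (g j x - y j)).
Proof.
rewrite /shifted_point/= vmean_update -/(vmean y) -/(g j x).
by apply/rowP => k; rewrite !mxE /m; field.
Qed.

Lemma probe_point_next j : probe_point (next j (x, y)) =
  x + - (lambda * tau) *: (g j x - y j).
Proof.
rewrite /probe_point/= vmean_update -/(vmean y) -/(g j x).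
by apply/rowP => k; rewrite !mxE /tau; field.
Qed.

Lemma memory_error_next z j : memory_error z (next j (x, y)) =
  memory_error z (x, y) + dotp (g j x - g j z) (g j x - g j z)
  - dotp (y j - g j z) (y j - g j z).
Proof.
rewrite /memory_error/= (bigD1 j)//= eqxx [in RHS](bigD1 j)//=.
rewrite (eq_bigr (fun i => dotp (y i - g i z) (y i - g i z))); last first.
  by move=> i /negPf ->.
rewrite -/(g j x); ring.
Qed.

Variable z : 'rV[R]_N.
Hypothesis zmin : argmin F z.

Let A := mean_gradient f x.
Let B := vmean y.
Let Ea := mean (fun i => dotp (g i x - g i z) (g i x - g i z)).
Let Eb := mean (fun i => dotp (y i - g i z) (y i - g i z)).
Let Eab := mean (fun i => dotp (g i x - y i) (g i x - y i)).

Let vmean_gz : vmean (fun i => g i z) = 0.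
Proof. exact: (argmin_mean_gradient n0 L0 hf zmin). Qed.

Let vmean_a : vmean (fun i => g i x - g i z) = A.
Proof. by rewrite vmeanB vmean_gz subr0. Qed.

Let vmean_b : vmean (fun i => y i - g i z) = B.
Proof. by rewrite vmeanB vmean_gz subr0. Qed.

Lemma sqr_mean_gradient_le :
  dotp (mean_gradient f x) (mean_gradient f x) <= n%:R^-1 * gradient_error z (x, y).
Proof. by rewrite -/A -vmean_a; exact: sqr_vmean_le. Qed.

Lemma sqr_vmean_memory_le :
  dotp (vmean y) (vmean y) <= n%:R^-1 * memory_error z (x, y).
Proof. by rewrite -/B -vmean_b; exact: sqr_vmean_le. Qed.

Let A_le : dotp A A <= Ea := sqr_mean_gradient_le.

Let B_le : dotp B B <= Eb := sqr_vmean_memory_le.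

Let Eab_parallelogram : Eab = 2 * Ea + 2 * Eb -
  mean (fun i => dotp (g i x - g i z + (y i - g i z)) (g i x - g i z + (y i - g i z))).
Proof.
rewrite -!meanZ -meanD -meanB; apply: eq_mean => i.
have -> : g i x - y i = (g i x - g i z) - (y i - g i z).
  by rewrite opprB addrA subrK.
move: (g i x - g i z) (y i - g i z) => a b; rewrite !dotpE (dotpC b a); ring.
Qed.

Let vmeanD_ab :
  vmean (fun i => g i x - g i z + (y i - g i z)) = A + B.
Proof. by rewrite -vmean_a -vmean_b /vmean big_split scalerDr. Qed.

Let Eab_le : Eab <= 2 * Ea + 2 * Eb - dotp (A + B) (A + B).
Proof. by rewrite Eab_parallelogram lerB// -vmeanD_ab sqr_vmean_le. Qed.

(** The term [- |A + B|^2] left over from the parallelogram identity absorbs the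
   cross term [2 <A, B>] of the second moment. *)
Let mean_shift : mean (fun j => dotp (shifted_point (next j (x, y)) - z)
                                (shifted_point (next j (x, y)) - z))
  <= dotp (shifted_point (x, y) - z) (shifted_point (x, y) - z)
     - 2 * lambda * dotp A (shifted_point (x, y) - z) 
     + 2 * lambda ^+ 2 * (Ea + Eb).
Proof.
set u := shifted_point (x, y) - z.
rewrite (eq_mean (b := fun j => dotp (u + (- lambda *: (B + (g j x - y j))))
   (u + (- lambda *: (B + (g j x - y j)))))); last first.
  by move=> j; rewrite shifted_point_next -/B addrAC.
rewrite mean_sqrDl//.
have vB : vmean (fun j => - lambda *: (B + (g j x - y j))) = - lambda *: A.
  rewrite /vmean -scaler_sumr scalerA mulrC -scalerA; congr (_ *: _).
  rewrite big_split sumrB/= scalerDr scalerBr sumr_const card_ord.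
  rewrite -[B *+ n]scaler_nat scalerA mulVf// scale1r.
  by rewrite -/(vmean y) -/B addrC subrK.
have E2 : mean (fun j => dotp (- lambda *: (B + (g j x - y j)))
     (- lambda *: (B + (g j x - y j)))) =
  lambda ^+ 2 * (dotp B B + 2 * dotp B (A - B) + Eab).
  have <- : vmean (fun j => g j x - y j) = A - B by rewrite vmeanB.
  rewrite -(@mean_sqrDl R n N B)// -meanZ.
  by apply: eq_mean => j; rewrite dotpZl dotpZr; ring.
rewrite vB E2 dotpZr (dotpC u A).
have l2 : 0 <= lambda ^+ 2 by rewrite sqr_ge0.
have : dotp B B + 2 * dotp B (A - B) + Eab <= 2 * (Ea + Eb).
  move: Eab_le (dotp_ge0 A) (dotp_ge0 B); move: (A) (B) => a b.
  rewrite !dotpE (dotpC b a); lra.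
by move=> /(ler_wpM2l l2); lra.
Qed.

Let mean_probe : mean (fun j => F (probe_point (next j (x, y)))) <=
  F x - lambda * tau * dotp A (A - B) + L / 2 * (lambda * tau) ^+ 2 * Eab.
Proof.
have -> : F x = mean (fun _ : 'I_n => F x) by rewrite mean_cst.
have <- : vmean (fun j => g j x - y j) = A - B by rewrite vmeanB.
rewrite -mean_dotpr -!meanZ -meanB -meanD; apply: ler_mean => j.
rewrite probe_point_next; apply: le_trans (average_descent n0 L0 hf _ _) _.
rewrite -/F -/A dotpZr !(dotpZl, dotpZr); lra.
Qed.

Let mean_memory : mean (fun j => memory_error z (next j (x, y))) =
  memory_error z (x, y) + Ea - Eb.
Proof.
rewrite -[X in X + Ea - Eb](mean_cst _ n0) -meanD -meanB.
by apply: eq_mean => j; exact: memory_error_next.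
Qed.

(** The term [2 lambda^2 m <A, B>] coming from the shift cancels against the
   lower bound of the old value at the probe point. *)
Let mean_lyapunov_le : mean (fun j => lyapunov z (next j (x, y))) <=
  lyapunov z (x, y) - 2 * lambda * dotp A (x - z) + lambda / L * (Ea - Eb)
  + lambda ^+ 2 * c * (Ea + Eb).
Proof.
have Ea0 : 0 <= Ea by apply: mean_ge0 => i; exact: dotp_ge0.
have Eb0 : 0 <= Eb by apply: mean_ge0 => i; exact: dotp_ge0.
have lm0 : 0 <= 2 * lambda * m by rewrite !mulr_ge0// ltW.
have l2m0 : 0 <= lambda ^+ 2 * m by rewrite mulr_ge0// sqr_ge0.
have -> : mean (fun j => lyapunov z (next j (x, y))) =
    mean (fun j => dotp (shifted_point (next j (x, y)) - z)
                        (shifted_point (next j (x, y)) - z))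
    + lambda / L * mean (fun j => memory_error z (next j (x, y)))
    + 2 * lambda * m * (mean (fun j => F (probe_point (next j (x, y)))) - F z).
  by rewrite -[X in _ - X](mean_cst (F z) n0) -meanB -!meanZ -!meanD.
have probe_le := ler_wpM2l lm0 mean_probe.
have probe_ge := ler_wpM2l lm0 (average_gradient_ineq L0 hf x (lambda *: B)).
have bias := ler_wpM2l l2m0 (quadratic_form_le tau A B).
(* As c is at least 2, the step-size bound gives L lambda <= 1 / 2, which absorbs
   the factor 2 in the bound of Eab by Ea + Eb. *)
have Lc : L * lambda <= 2^-1.
  have := svag_const_ge2 n0 htheta; rewrite -/c => c2.
  have := ler_wpM2l (ltW (mulr_gt0 lambda0 L0)) c2; move: hstep; rewrite -/c; lra.
have Eab0 : 0 <= Eab by apply: mean_ge0 => i; exact: dotp_ge0.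
have curvature : lambda ^+ 2 * m * (tau ^+ 2 * (L * lambda * Eab))
    <= lambda ^+ 2 * m * (tau ^+ 2 * (Ea + Eb)).
  rewrite ler_wpM2l// ler_wpM2l ?sqr_ge0//.
  apply: le_trans (ler_wpM2r Eab0 Lc) _.
  by move: Eab_le (dotp_ge0 (A + B)); lra.
have kappa0 : 0 <= Num.sqrt 2 * `|tau| - tau by exact: svag_kappa_ge0.
have bias' : lambda ^+ 2 * m * ((Num.sqrt 2 * `|tau| - tau) * (dotp A A + dotp B B))
    <= lambda ^+ 2 * m * ((Num.sqrt 2 * `|tau| - tau) * (Ea + Eb)).
  by rewrite ler_wpM2l// ler_wpM2l// lerD.
have := mean_shift; rewrite mean_memory /lyapunov.
have -> : shifted_point (x, y) - z = (x - z) - (lambda * m) *: B.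
  by rewrite /shifted_point/= addrAC.
rewrite [in X in X -> _](dotpDr A) dotpNr dotpZr.
move: probe_ge; rewrite dotpZr -/A -/F -/(probe_point (x, y)) => probe_ge.
rewrite /c (svag_constE theta n0) -/tau -/m.
move: (dotp (x - z - (lambda * m) *: B) _) (memory_error _ _) => V0 M0.
move: (mean _) (mean _) probe_le => MV MF probe_le.
lra.
Qed.

Lemma lyapunov_drift : mean (fun j => lyapunov z (next j (x, y))) <=
  lyapunov z (x, y) - lambda * (L^-1 - lambda * c) *
     (n%:R^-1 * (gradient_error z (x, y) + memory_error z (x, y))).
Proof.
apply: le_trans mean_lyapunov_le _.
have := mean_cocoercive L0 hf x z.
rewrite (argmin_mean_gradient n0 L0 hf zmin) subr0 -/A -/Ea.
rewrite -ler_pdivrMl// => coco.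
have := ler_wpM2l (ltW lambda0) coco.
have -> : n%:R^-1 * (gradient_error z (x, y) + memory_error z (x, y)) = Ea + Eb.
  by rewrite mulrDr.
move: (dotp _ _) => D; lra.
Qed.

(** Cocoercivity converts the gradient errors into [L <A, x - z>], and convexity
   bounds this inner product below by the value gap. *)
Lemma lyapunov_drift_value : mean (fun j => lyapunov z (next j (x, y))) <=
  lyapunov z (x, y) - lambda * (1 - L * lambda * c) * (F x - F z).
Proof.
apply: le_trans mean_lyapunov_le _.
have := mean_cocoercive L0 hf x z.
rewrite (argmin_mean_gradient n0 L0 hf zmin) subr0 -/A -/Ea => coco.
have Eb0 : 0 <= Eb by apply: mean_ge0 => i; exact: dotp_ge0.
have := average_gradient_ineq L0 hf x (z - x).
rewrite [x + _]addrC subrK -/F -/A -opprB dotpNr => convex.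
move: coco convex; move: (dotp _ _) => D coco convex.
have Li : L * L^-1 = 1 by rewrite divff// gt_eqF.
have lLi0 : 0 <= lambda / L by rewrite divr_ge0// ltW.
have c0 : 0 <= c by apply: le_trans (svag_const_ge2 n0 htheta).
have k0 : 0 <= lambda / L + lambda ^+ 2 * c.
  by rewrite addr_ge0// mulr_ge0// sqr_ge0.
have := ler_wpM2l k0 coco => coco'.
have k1 : 0 <= lambda * (1 - L * lambda * c).
  by rewrite mulr_ge0 ?(ltW lambda0)// subr_ge0 ltW// [L * _]mulrC.
have k2 : 0 <= lambda / L * (1 - L * lambda * c).
  by rewrite mulr_ge0// subr_ge0 ltW// [L * _]mulrC.
have E : lambda / L * (L * lambda * c) = lambda ^+ 2 * c by field; rewrite gt_eqF.
have E' : (lambda / L + lambda ^+ 2 * c) * (L * D) =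
    lambda * D + L * lambda ^+ 2 * c * D.
  by field; rewrite gt_eqF.
have := mulr_ge0 k2 Eb0; rewrite mulrBr E mulr1 => memory.
have convex' : F x - F z <= D by lra.
have := ler_wpM2l k1 convex'.
move: coco'; rewrite E'; set l := lambda / L in memory *; lra.
Qed.

End OneStep.
End Drift.

(** * Finitely valued random variables *)

Section FiniteOver.
Context {T : Type}.
Implicit Types G : set (set T).

(** Factoring through a finite partition by events of [G] makes every function
   of such variables again one of the same kind, without any measurability
   requirement on the function. *)
Definition finite_over G {S : Type} (X : T -> S) : Prop :=
  exists (I : finType) (code : T -> I) (decode : I -> S),
    (forall i, G (code @^-1` [set i])) /\ forall w, X w = decode (code w).

Lemma finite_over_comp G {S S' : Type} (X : T -> S) (h : S -> S') :
  finite_over G X -> finite_over G (fun w => h (X w)).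
Proof.
move=> [I [e [p [Ge Xe]]]]; exists I, e, (h \o p); split=> // w.
by rewrite Xe.
Qed.

Lemma finite_over_sub G G' {S : Type} (X : T -> S) :
  G `<=` G' -> finite_over G X -> finite_over G' X.
Proof.
move=> GG' [I [e [p [Ge Xe]]]]; exists I, e, p; split=> // i.
exact: GG'.
Qed.

Lemma sigma_algebra_setI G A B : sigma_algebra setT G -> G A -> G B -> G (A `&` B).
Proof.
move=> [G0 GD GU] GA GB.
have GC A' : G A' -> G (~` A') by rewrite -setTD; exact: GD.
rewrite -[A `&` B]setCK setCI -bigcup2E; apply/GC/GU => -[|[|k]]/=.
- exact: GC.
- exact: GC.
- exact: G0.
Qed.

Lemma sigma_algebra_fin_bigcup G (I : finType) (D : pred I) (A : I -> set T) :
  sigma_algebra setT G -> (forall i, D i -> G (A i)) ->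
  G (\bigcup_(i in [set i | D i]) A i).
Proof.
move=> [G0 GD GU] GA.
have -> : \bigcup_(i in [set i | D i]) A i =
   \bigcup_k (if nth None [seq Some i | i <- enum D] k is Some i then A i else set0).
  apply/seteqP; split=> w /= [].
    move=> i /= Di Aiw; exists (index (Some i) [seq Some i | i <- enum D]) => //.
    rewrite nth_index//; apply/mapP; exists i => //.
    by rewrite mem_enum.
  move=> k _; case E: (nth _ _ _) => [i|//] Aiw; exists i => //=.
  have : Some i \in [seq Some i | i <- enum D].
    rewrite -E mem_nth// ltnNge; apply/negP => h.
    by rewrite nth_default// in E.
  by move=> /mapP[j]; rewrite mem_enum => Dj [->].
apply: GU => k; case E: (nth _ _ _) => [i|//]; apply: GA.
have : Some i \in [seq Some i | i <- enum D].
  rewrite -E mem_nth// ltnNge; apply/negP => h.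
  by rewrite nth_default// in E.
by move=> /mapP[j]; rewrite mem_enum => Dj [->].
Qed.

Lemma finite_over_pair G {S S' : Type} (X : T -> S) (Y : T -> S') :
  sigma_algebra setT G -> finite_over G X -> finite_over G Y ->
  finite_over G (fun w => (X w, Y w)).
Proof.
move=> sG [I [e [p [Ge Xe]]]] [I' [e' [p' [Ge' Xe']]]].
exists (I * I')%type, (fun w => (e w, e' w)), (fun i => (p i.1, p' i.2)).
split=> [[i i']|w]; last by rewrite Xe Xe'.
have -> : (fun w => (e w, e' w)) @^-1` [set (i, i')] =
   (e @^-1` [set i]) `&` (e' @^-1` [set i']).
  by apply/seteqP; split=> w /= => [[-> ->]|[-> ->]].
exact: sigma_algebra_setI.
Qed.

Lemma finite_over_preimage G {S : Type} (X : T -> S) (B : set S) :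
  sigma_algebra setT G -> finite_over G X -> G (X @^-1` B).
Proof.
move=> sG [I [e [p [Ge Xe]]]].
have -> : X @^-1` B = \bigcup_(i in [set i | `[< B (p i) >]]) e @^-1` [set i].
  apply/seteqP; split=> w /=.
    by rewrite Xe => Bp; exists (e w) => //=; exact/asboolP.
  by move=> [i /= /asboolP Bp ew]; rewrite Xe ew.
by apply: sigma_algebra_fin_bigcup.
Qed.

Lemma finite_over_cst G {S : Type} (s : S) :
  sigma_algebra setT G -> finite_over G (fun=> s).
Proof.
move=> sG; exists unit, (fun=> tt), (fun=> s); split=> // i.
have -> : (fun=> tt) @^-1` [set i] = ~` set0 :> set T.
  by apply/seteqP; split=> // w _; case: i.
by case: sG => G0 GD _; rewrite -setTD; exact: GD.
Qed.

End FiniteOver.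

Section FiniteRange.
Context {T : Type}.
Implicit Types G : set (set T).

Lemma sigma_algebra_fin_bigcap G (I : finType) (A : I -> set T) :
  sigma_algebra setT G -> (forall i, G (A i)) -> G [set w | forall i, A i w].
Proof.
move=> sG GA; have GC B : G B -> G (~` B).
  by case: (sG) => _ GD _; rewrite -setTD; exact: GD.
have -> : [set w | forall i, A i w] =
    ~` \bigcup_(i in [set i | predT i]) ~` A i.
  apply/seteqP; split=> w /= h; first by move=> [i _]; apply; exact: h.
  by move=> i; apply: contrapT => Aiw; apply: h; exists i.
apply: (GC); apply: sigma_algebra_fin_bigcup; first exact: sG.
by move=> i _; exact: (GC _ (GA i)).
Qed.

(** The range may have repeated indices, and the index of [X w] need not be
   measurable; a canonical choice of index is. *)
Lemma finite_over_of_range G {S : Type} (X : T -> S) (I : finType) (p : I -> S) :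
  sigma_algebra setT G -> (forall a, G (X @^-1` [set a])) ->
  (forall w, exists i, X w = p i) -> S -> finite_over G X.
Proof.
move=> sG GX Xp default.
(* Among the indices of a value one is singled out by a function of the value. *)
pose pick_index a : option I := [pick i | `[< a = p i >]].
exists (option I), (fun w => pick_index (X w)).
exists (fun o => if o is Some i then p i else default).
split=> [c|w].
  have -> : (fun w => pick_index (X w)) @^-1` [set c] =
      \bigcup_(i in [set i | pick_index (p i) == c]) X @^-1` [set p i].
    apply/seteqP; split=> w /=.
      by have [i Xi] := Xp w; rewrite Xi => <-; exists i => /=.
    by move=> [i /= /eqP <- ->].
  by apply: sigma_algebra_fin_bigcup.
rewrite /pick_index; case: pickP => [i /asboolP //|none].
by have [i /asboolP] := Xp w; rewrite none.
Qed.

End FiniteRange.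

Section Expectation.
Context {R : realType} {d : measure_display} {T : measurableType d}.
Variable P : probability T R.
Implicit Types X Y : T -> R.

Definition expect X : R := Rintegral P setT X.

Definition simple X : Prop := finite_over (@measurable d T) X.

Lemma simple_measurable X : simple X -> measurable_fun setT X.
Proof.
move=> sX _ B _; rewrite setTI.
exact: (finite_over_preimage _ (@sigma_algebra_measurable _ T)).
Qed.

Lemma simple_integrable X : simple X -> P.-integrable setT (EFin \o X).
Proof.
move=> sX; apply: measurable_bounded_integrable => //.
- by rewrite (le_lt_trans (probability_le1 _ _))// ltry.
- exact: simple_measurable.
- have [I [e [p [_ Xe]]]] := sX.
  exists (\sum_i `|p i|); split; first exact: num_real.
  move=> M lM w _ /=; rewrite Xe; apply: le_trans (ltW lM).
  by rewrite (bigD1 (e w))//= lerDl sumr_ge0.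
Qed.

Lemma expectE X : simple X -> ('E_P[X] = (expect X)%:E)%E.
Proof.
move=> sX; rewrite unlock /expect /Rintegral fineK//.
exact: integrable_fin_num (simple_integrable sX).
Qed.

Lemma expectD X Y : simple X -> simple Y ->
  expect (fun w => X w + Y w) = expect X + expect Y.
Proof. by move=> sX sY; rewrite /expect RintegralD//; exact: simple_integrable. Qed.

Lemma expectZ c X : simple X -> expect (fun w => c * X w) = c * expect X.
Proof. by move=> sX; rewrite /expect RintegralZl//; exact: simple_integrable. Qed.

Lemma le_expect X Y : simple X -> simple Y ->
  (forall w, X w <= Y w) -> expect X <= expect Y.
Proof. by move=> sX sY XY; apply: le_Rintegral => //; exact: simple_integrable. Qed.

Lemma expect_ge0 X : (forall w, 0 <= X w) -> 0 <= expect X.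
Proof. by move=> X0; exact: Rintegral_ge0. Qed.

Lemma expect_cst c : expect (fun=> c) = c.
Proof.
rewrite /expect Rintegral_cst// -[fine _]/(fine (P setT)).
by rewrite probability_setT mulr1.
Qed.

Lemma simple_op2 (h : R -> R -> R) X Y : simple X -> simple Y ->
  simple (fun w => h (X w) (Y w)).
Proof.
move=> sX sY.
exact: (finite_over_comp (fun p => h p.1 p.2)
  (finite_over_pair (@sigma_algebra_measurable _ T) sX sY)).
Qed.

Lemma simple_sum (I : Type) (r : seq I) (X : I -> T -> R) :
  (forall i, simple (X i)) -> simple (fun w => \sum_(i <- r) X i w).
Proof.
move=> sX; elim: r => [|i r IH].
  under eq_fun do rewrite big_nil.
  exact: (finite_over_cst _ (@sigma_algebra_measurable _ T)).
under eq_fun do rewrite big_cons.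
exact: (simple_op2 +%R (sX i) IH).
Qed.

Lemma expect_sum (I : Type) (r : seq I) (X : I -> T -> R) :
  (forall i, simple (X i)) ->
  expect (fun w => \sum_(i <- r) X i w) = \sum_(i <- r) expect (X i).
Proof.
move=> sX; elim: r => [|i r IH].
  by rewrite big_nil; under eq_fun do rewrite big_nil; rewrite expect_cst.
rewrite big_cons -IH -expectD//; last exact: simple_sum.
by congr expect; apply/funext => w; rewrite big_cons.
Qed.

Lemma expect_code (I : finType) (e : T -> I) (p : I -> R) :
  (forall i, measurable (e @^-1` [set i])) ->
  expect (fun w => p (e w)) = \sum_i p i * fine (P (e @^-1` [set i])).
Proof.
move=> me.
have -> : (fun w => p (e w)) = (fun w => \sum_i p i * \1_(e @^-1` [set i]) w).
  apply/funext => w; rewrite (bigD1 (e w))//= indicE mem_set// mulr1.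
  rewrite big1 ?addr0// => i; rewrite eq_sym => /eqP ei.
  by rewrite indicE memNset// mulr0.
have s1 i : simple (\1_(e @^-1` [set i]) : T -> R).
  exists I, e, (fun j => (j == i)%:R); split=> // w.
  by rewrite indicE; congr ((nat_of_bool _)%:R); apply/idP/eqP; rewrite inE.
rewrite expect_sum => [|i]; last exact: (finite_over_comp (fun r => p i * r) (s1 i)).
apply: eq_bigr => i _; rewrite expectZ//; congr (_ * _).
by rewrite /expect /Rintegral integral_indic// setIT.
Qed.

End Expectation.

Section Sampling.
Context {R : realType} {d : measure_display} {T : measurableType d}.
Context (P : probability T R) {n : nat} (G : nat -> set (set T)).
Variable idx : nat -> T -> 'I_n.
Hypotheses (hG : filtration G) (hidx : uniform_sampling P G idx).

Lemma filtration_measurable k {S : Type} (X : T -> S) :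
  finite_over (G k) X -> finite_over (@measurable d T) X.
Proof. by case: hG => _ Gm _; apply: finite_over_sub; exact: Gm. Qed.

Lemma sample_finite_over k : finite_over (@measurable d T) (idx k).
Proof. by exists 'I_n, (idx k), id; split=> // j; case: (hidx k j). Qed.

Lemma expect_sample_indic k j (X : T -> R) : finite_over (G k) X ->
  expect P (fun w => X w * (idx k w == j)%:R) = n%:R^-1 * expect P X.
Proof.
move=> fX; have [I [e [p [Ge Xe]]]] := fX; case: hG => _ Gm _.
have me i : measurable (e @^-1` [set i]) by apply: (Gm k).
(* The product is a function of the joint code of X and of the event. *)
pose e' w := (e w, idx k w == j).
have me' i : measurable (e' @^-1` [set i]).
  have [mj _ _] := hidx k j.
  have Eb b : e' @^-1` [set (i.1, b)] = e @^-1` [set i.1] `&`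
     (if b then idx k @^-1` [set j] else ~` (idx k @^-1` [set j])).
    apply/seteqP; split=> w; rewrite /e'/=.
      by move=> [-> <-]; case: eqP.
    by move=> [<-]; case: b => /= [->|/eqP/negPf ->]; rewrite ?eqxx.
  case: i Eb => i b Eb; rewrite Eb; apply: measurableI => //=.
  by case: b {Eb} => //; exact: measurableC.
have -> : expect P X = \sum_i p i * fine (P (e @^-1` [set i])).
  by rewrite -expect_code//; congr expect; apply/funext.
pose p' (i : I * bool) := p i.1 * i.2%:R.
have -> : (fun w => X w * (idx k w == j)%:R) = (fun w => p' (e' w)).
  by apply/funext => w; rewrite Xe.
rewrite (expect_code P p' me').
rewrite (eq_bigr (fun ib => p' (ib.1, ib.2) *
  fine (P (e' @^-1` [set (ib.1, ib.2)])))); last by case.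
rewrite -(pair_bigA _ (fun i b => p' (i, b) * fine (P (e' @^-1` [set (i, b)]))))/=.
rewrite mulr_sumr; apply: eq_bigr => i _.
rewrite big_bool/p'/= mulr0 mul0r addr0 mulr1 mulrCA; congr (_ * _).
have -> : e' @^-1` [set (i, true)] = e @^-1` [set i] `&` idx k @^-1` [set j].
  apply/seteqP; split=> w; rewrite /e'/=.
    by move=> [-> /eqP].
  by move=> [-> /eqP ->].
have [_ Pj /(_ _ (Ge i)) ->] := hidx k j.
by rewrite Pj fineM ?fin_num_measure//= mulrC.
Qed.

(** This is the conditional expectation given the past: the fresh sample may be
   averaged out inside any function of it and of earlier variables. *)
Lemma expect_sample k (X : 'I_n -> T -> R) :
  (forall j, finite_over (G k) (X j)) ->
  expect P (fun w => X (idx k w) w) = expect P (fun w => mean (fun j => X j w)).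
Proof.
move=> fX; have sX j : simple (X j) := filtration_measurable (fX j).
have sj j : simple (fun w => (idx k w == j)%:R : R).
  exact: (finite_over_comp (fun i => (i == j)%:R) (sample_finite_over k)).
have -> : (fun w => X (idx k w) w) =
          (fun w => \sum_j X j w * (idx k w == j)%:R).
  apply/funext => w; rewrite (bigD1 (idx k w))//= eqxx mulr1.
  by rewrite big1 ?addr0// => j /negPf; rewrite eq_sym => ->; rewrite mulr0.
rewrite expect_sum => [|j]; last exact: simple_op2.
rewrite expectZ; last exact: simple_sum.
rewrite expect_sum// mulr_sumr; apply: eq_bigr => j _.
exact: expect_sample_indic.
Qed.

End Sampling.

(** * Almost sure convergence *)

Section AlmostSure.
Context {R : realType} {d : measure_display} {T : measurableType d}.
Variable P : probability T R.

(** The sum of the series has a finite mean, hence is almost surely finite. *)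
Lemma ae_cvg0_of_summable (X : nat -> T -> R) (C : R) :
  (forall k, simple (X k)) -> (forall k w, 0 <= X k w) ->
  (forall m, \sum_(k < m) expect P (X k) <= C) ->
  {ae P, forall w, X k w @[k --> \oo] --> (0 : R)}.
Proof.
move=> sX X0 XC.
have mX k : measurable_fun setT (fun w => (X k w)%:E).
  by apply/measurable_EFinP; exact: simple_measurable.
pose S w := (\sum_(k <oo) (X k w)%:E)%E.
have iS : (\int[P]_w S w <= C%:E)%E.
  rewrite integral_nneseries//; last by move=> k w _; rewrite lee_fin.
  apply: lime_le.
    apply: is_cvg_nneseries => k _ _.
    by apply: integral_ge0 => w _; rewrite lee_fin.
  apply: nearW => m; rewrite big_mkord.
  rewrite (eq_bigr (fun k : 'I_m => (expect P (X k))%:E)) => [|k _].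
    by rewrite sumEFin lee_fin; exact: XC.
  by rewrite -(expectE P (sX k)) unlock.
have S0 w : (0 <= S w)%E by apply: nneseries_ge0 => k _ _; rewrite lee_fin.
have mS : measurable_fun setT S.
  by apply: ge0_emeasurable_sum => // k w _ _; rewrite lee_fin.
have Si : P.-integrable setT S.
  apply/integrableP; split=> //.
  rewrite (eq_integral S); first exact: le_lt_trans iS (ltry _).
  by move=> w _; rewrite gee0_abs.
have := integrable_ae measurableT Si; apply: filterS => w /(_ I) Sw.
have cX : cvgn (series (X ^~ w)).
  apply: nondecreasing_is_cvgn.
    by apply: nondecreasing_series => k _ _.
  exists (fine (S w)) => _ [m _ <-].
  rewrite -lee_fin fineK// /series/= -sumEFin.
  by apply: nneseries_lim_ge => k _ _; rewrite lee_fin.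
exact: cvg_series_cvg_0.
Qed.

End AlmostSure.

Section Upcrossing.
Context {R : realType}.
Variables (a b : R) (v : nat -> R).

(** The buy-low sell-high strategy: [holding k] says whether one share is held
   between times [k] and [k + 1]; it is bought below [a], sold above [b]. *)
Fixpoint holding (k : nat) : bool :=
  if k is k'.+1 then (if holding k' then v k <= b else v k < a) else v 0 < a.

Definition selling (k : nat) : bool := holding k && (b < v k.+1).

(** Every completed sale earns at least [b - a], and an open position has lost at
   most [a], the price being nonnegative. *)
Lemma trading_gain_ge m : a < b -> (forall k, 0 <= v k) ->
  (b - a) * \sum_(k < m) (selling k)%:R - `|a|
  <= \sum_(k < m) (holding k)%:R * (v k.+1 - v k).
Proof.
move=> ab v0.
have a0 := normr_ge0 a; have aa := ler_norm a.
(* The induction needs the open position at its current price. *)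
suff H : (b - a) * \sum_(k < m) (selling k)%:R + (holding m)%:R * (v m - a)
         <= \sum_(k < m) (holding k)%:R * (v k.+1 - v k).
  apply: le_trans H; rewrite lerD2l; have := v0 m.
  by case: holding => /=; rewrite ?mul1r ?mul0r; lra.
elim: m => [|m IH].
  rewrite !big_ord0 mulr0 add0r /=.
  by case: (ltP (v 0) a) => h; rewrite ?mul1r ?mul0r; lra.
rewrite !big_ord_recr/= /selling; move: IH.
case: (holding m) => /= IH; last first.
  by case: (ltP (v m.+1) a) => h /=; rewrite ?mul1r ?mul0r; lra.
by case: (leP (v m.+1) b) => h /=; rewrite ?mul1r ?mul0r; lra.
Qed.

(** After the last sale either a share is kept forever, with prices never above
   [b], or none is ever bought, with prices never below [a]. *)
Lemma finite_selling_sided :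
  (\forall k \near \oo, ~~ selling k) ->
  (\forall k \near \oo, a <= v k) \/ (\forall k \near \oo, v k <= b).
Proof.
move=> [K _ HK].
have [[k Kk hk]|nh] := pselect (exists2 k, (K <= k)%N & holding k).
  right; exists k.+1 => // -[//|j] /=; rewrite ltnS => /subnK <-.
  have : holding (j - k + k) && (v (j - k + k).+1 <= b).
    elim: (j - k)%N => [|i /andP[hi vi]].
      by rewrite add0n hk; have := HK k Kk; rewrite /= /selling hk /= -leNgt.
    rewrite addSn /= hi vi/=.
    have := HK (i + k).+1; rewrite /selling/= hi vi/= -leNgt; apply.
    by rewrite (leq_trans Kk)// -addSn leq_addl.
  by case/andP.
left; exists K.+1 => // -[//|j] /=; rewrite ltnS => Kj.
have nhj i : (K <= i)%N -> ~~ holding i.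
  by move=> Ki; apply/negP => hi; apply: nh; exists i.
have := nhj j.+1 (leq_trans Kj (leqnSn _)); rewrite /= (negPf (nhj j Kj)).
by rewrite -leNgt.
Qed.

End Upcrossing.

(** The limit is the supremum of the rational numbers that eventually bound the
   sequence from below. *)
Lemma cvg_of_no_oscillation (R : realType) (v : nat -> R) (B : R) :
  (forall k, 0 <= v k) -> ~ (\forall k \near \oo, B <= v k) ->
  (forall q r : rat, q < r ->
    (\forall k \near \oo, ratr q <= v k) \/ (\forall k \near \oo, v k <= ratr r)) ->
  cvgn v.
Proof.
move=> v0 vB osc.
pose S := [set s : R | exists2 q : rat,
  s = ratr q & \forall k \near \oo, ratr q <= v k].
have S0 : S 0 by exists 0; [rewrite rmorph0|exists 0%N => // k _; rewrite rmorph0].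
have SB s : S s -> s <= B.
  move=> [q -> qv]; rewrite leNgt; apply/negP => Bq; apply: vB.
  by apply: filterS qv => k; apply: le_trans; exact: ltW.
have hS : has_sup S by split; [exists 0|exists B => s /SB].
apply/cvg_ex; exists (sup S); apply/cvgrPdist_le => e e0.
have [s [q sq qv] ls] := sup_adherent e0 hS; rewrite sq in ls.
have lt1 : sup S < sup S + e / 2 by rewrite ltrDl divr_gt0.
have lt2 : sup S + e / 2 < sup S + e by rewrite ltrD2l ltr_pdivrMr// ltr_pMr// ltr1n.
have [r1] := rat_in_itvoo lt1; rewrite in_itv/= => /andP[lr1 r1u].
have [r2] := rat_in_itvoo lt2; rewrite in_itv/= => /andP[lr2 r2u].
have r12 : r1 < r2 by rewrite -(ltr_rat R) (lt_trans r1u).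
have [vr1|vr2] := osc _ _ r12.
  have : ratr r1 <= sup S by apply: ub_le_sup => //; [case: hS|exists r1].
  by rewrite leNgt lr1.
near=> k; rewrite ler_distlC; apply/andP; split.
  by apply: le_trans (ltW ls) _; near: k.
by apply: le_trans (ltW r2u); near: k.
Unshelve. all: by end_near. Qed.

Section Supermartingale.
Context {R : realType} {d : measure_display} {T : measurableType d}.
Variables (P : probability T R) (G : nat -> set (set T)).
Variable X : nat -> T -> R.
Hypotheses (hG : filtration G) (adaptedX : forall k, finite_over (G k) (X k))
  (X0 : forall k w, 0 <= X k w)
  (superX : forall k (H : T -> R), finite_over (G k) H -> (forall w, 0 <= H w) ->
     expect P (fun w => H w * X k.+1 w) <= expect P (fun w => H w * X k w)).

Let sigmaG k : sigma_algebra setT (G k). Proof. by case: hG. Qed.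

Let simpleX k : simple (X k). Proof. exact: filtration_measurable (adaptedX k). Qed.

Lemma holding_adapted a b k :
  finite_over (G k) (fun w => holding a b (X ^~ w) k).
Proof.
elim: k => [|k IH] /=; first exact: finite_over_comp (fun r => r < a) (adaptedX 0).
apply: (finite_over_comp (fun p : bool * R => if p.1 then p.2 <= b else p.2 < a)
  (finite_over_pair (sigmaG k.+1) (finite_over_sub _ IH) (adaptedX k.+1))).
by case: hG.
Qed.

(** Trading in a supermartingale has no positive mean gain, so the expected
   number of sales is at most [|a| / (b - a)]: almost surely they stop. *)
Lemma ae_sided (a b : R) : a < b ->
  {ae P, forall w, (\forall k \near \oo, a <= X k w) \/
                   (\forall k \near \oo, X k w <= b)}.
Proof.
move=> ab.
have sH k : simple (fun w => (holding a b (X ^~ w) k)%:R : R).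
  exact: (finite_over_comp (fun c : bool => c%:R)
    (filtration_measurable hG (holding_adapted a b k))).
have sS k : simple (fun w => (selling a b (X ^~ w) k)%:R : R).
  exact: (finite_over_comp (fun p : bool * R => (p.1 && (b < p.2))%:R)
    (finite_over_pair (@sigma_algebra_measurable _ T)
      (filtration_measurable hG (holding_adapted a b k)) (simpleX k.+1))).
have sD k : simple (fun w => X k.+1 w - X k w).
  exact: (simple_op2 (fun x y => x - y) (simpleX k.+1) (simpleX k)).
have sHD k : simple (fun w => (holding a b (X ^~ w) k)%:R * (X k.+1 w - X k w)).
  exact: (simple_op2 *%R (sH k) (sD k)).
have loss k : expect P (fun w => (holding a b (X ^~ w) k)%:R * (X k.+1 w - X k w)) <= 0.
  have sHX l : simple (fun w => (holding a b (X ^~ w) k)%:R * X l w).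
    exact: (simple_op2 *%R (sH k) (simpleX l)).
  have E : (fun w => (holding a b (X ^~ w) k)%:R * (X k.+1 w - X k w)) =
     (fun w => (holding a b (X ^~ w) k)%:R * X k.+1 w
               + - 1 * ((holding a b (X ^~ w) k)%:R * X k w)).
    by apply/funext => w; ring.
  rewrite E expectD//; last exact: (finite_over_comp ( *%R (- 1)) (sHX k)).
  rewrite expectZ// mulN1r subr_le0; apply: superX => //.
  exact: (finite_over_comp (fun c : bool => c%:R) (holding_adapted a b k)).
have : {ae P, forall w, (selling a b (X ^~ w) k)%:R @[k --> \oo] --> (0 : R)}.
  apply: (@ae_cvg0_of_summable _ _ _ P _ (`|a| / (b - a))) => // m.
  have ba : 0 < b - a by rewrite subr_gt0.
  rewrite ler_pdivlMr// mulrC -expect_sum// -expectZ; last exact: simple_sum.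
  have sgain : simple (fun w =>
      \sum_(k < m) (holding a b (X ^~ w) k)%:R * (X k.+1 w - X k w)).
    exact: simple_sum.
  have scst : simple (fun _ : T => `|a|).
    exact: (finite_over_cst _ (@sigma_algebra_measurable _ T)).
  apply: (@le_trans _ _ (expect P (fun w => `|a| +
      \sum_(k < m) (holding a b (X ^~ w) k)%:R * (X k.+1 w - X k w)))).
    apply: le_expect => [||w].
    - exact: (finite_over_comp (fun r => (b - a) * r)
        (simple_sum (index_enum 'I_m) (fun k : 'I_m => sS k))).
    - exact: (simple_op2 +%R scst sgain).
    - rewrite -lerBlDl; exact: trading_gain_ge.
  rewrite expectD// expect_cst gerDl expect_sum//.
  by apply: sumr_le0 => k _; exact: loss.
apply: filterS => w /cvgrPdist_lt /(_ 1 ltr01) sell0.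
apply: finite_selling_sided; apply: filterS sell0 => k.
by case: selling => //=; rewrite sub0r normrN normr1 ltxx.
Qed.

Lemma expect_supermartingale_le k : expect P (X k) <= expect P (X 0).
Proof.
elim: k => // k; apply: le_trans.
have E (Y : T -> R) : Y = (fun w => 1 * Y w) by apply/funext => w; rewrite mul1r.
rewrite (E (X k.+1)) (E (X k)); apply: superX => //.
exact: finite_over_cst.
Qed.

(** Fatou's lemma bounds the mean of the lower limit by the initial mean. *)
Lemma ae_not_diverging :
  {ae P, forall w, exists B, ~ (\forall k \near \oo, B <= X k w)}.
Proof.
have mX k : measurable_fun setT (fun w => (X k w)%:E).
  by apply/measurable_EFinP; exact: simple_measurable.
pose S w := limn_einf (fun k => (X k w)%:E).
have mS : measurable_fun setT S.
  apply: (emeasurable_fun_cvg (fun k w => einfs (fun l => (X l w)%:E) k)).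
    exact: measurable_fun_einfs.
  by move=> w _; rewrite /S limn_einf_lim; exact: is_cvg_einfs.
have S0 w : (0 <= S w)%E.
  rewrite /S limn_einf_lim; apply: lime_ge; first exact: is_cvg_einfs.
  by apply: nearW => k; apply: le_ereal_inf_tmp => _ [m _ <-]; rewrite lee_fin.
have iS : (\int[P]_w S w <= (expect P (X 0))%:E)%E.
  have X0' k w : setT w -> (0 <= (X k w)%:E)%E by rewrite lee_fin.
  apply: le_trans (@fatou _ _ _ P _ measurableT (fun k w => (X k w)%:E) mX X0') _.
  rewrite limn_einf_lim; apply: lime_le; first exact: is_cvg_einfs.
  apply: nearW => k; apply: le_trans (ereal_inf_lbound _) _; first by exists k => /=.
  have -> : (\int[P]_w (X k w)%:E = (expect P (X k))%:E)%E.
    by rewrite -(expectE P (simpleX k)) unlock.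
  by rewrite lee_fin expect_supermartingale_le.
have Si : P.-integrable setT S.
  apply/integrableP; split=> //.
  rewrite (eq_integral S); first exact: le_lt_trans iS (ltry _).
  by move=> w _; rewrite gee0_abs.
have := integrable_ae measurableT Si; apply: filterS => w /(_ I) Sw.
exists (fine (S w) + 1) => [[K _ HK]].
suff : ((fine (S w) + 1)%:E <= S w)%E.
  by rewrite -[leRHS]fineK// lee_fin gerDl ler10.
rewrite [leRHS]limn_einf_lim; apply: lime_ge; first exact: is_cvg_einfs.
exists K => // k /= Kk; apply: le_ereal_inf_tmp => _ [m /= km <-].
by rewrite lee_fin; apply: HK; rewrite /= (leq_trans Kk).
Qed.

(** Doob's theorem: oscillation between any two of countably many levels and
   divergence to infinity are both excluded almost surely. The supermartingale
   property is tested against nonnegative weights from the past. *)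
Theorem supermartingale_ae_cvg : {ae P, forall w, cvgn (X ^~ w)}.
Proof.
have H : {ae P, forall w (i : nat), if unpickle i is Some (q, r) then
   (q < r :> rat) -> (\forall k \near \oo, ratr q <= X k w) \/
   (\forall k \near \oo, X k w <= ratr r) else True}.
  apply: ae_foralln => i; case: unpickle => [[q r]|]; last exact: nearW.
  have [qr|_] := boolP (q < r); last exact: nearW.
  by apply: filterS (@ae_sided (ratr q) (ratr r) _) => //; rewrite ltr_rat.
apply: filterS2 ae_not_diverging H => w [B hB] Hw.
apply: (@cvg_of_no_oscillation _ _ B) => // q r qr.
by have := Hw (pickle (q, r)); rewrite pickleK; apply.
Qed.

End Supermartingale.

(** * Processes driven by uniform samples with a mean decrease *)

Section SampledDrift.
Context {R : realType} {d : measure_display} {T : measurableType d}.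
Context (P : probability T R) {n : nat} {S : Type} (G : nat -> set (set T)).
Variables (idx : nat -> T -> 'I_n) (next : 'I_n -> S -> S).
Variables (s : nat -> T -> S) (s0 : S).
Hypotheses (hG : filtration G) (hidx : uniform_sampling P G idx).
Hypotheses (s_init : forall w, s 0 w = s0)
  (s_next : forall k w, s k.+1 w = next (idx k w) (s k w))
  (adapted_s : forall k, finite_over (G k) (s k)).
Variables V D : S -> R.
Hypotheses (V0 : forall a, 0 <= V a) (D0 : forall a, 0 <= D a)
  (drift : forall a, mean (fun j => V (next j a)) <= V a - D a).

Let sigmaG k : sigma_algebra setT (G k). Proof. by case: hG. Qed.

Let simple_s (h : S -> R) k : simple (fun w => h (s k w)).
Proof. exact: (finite_over_comp h (filtration_measurable hG (adapted_s k))). Qed.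

Lemma expect_weighted_drift k (H : T -> R) :
  finite_over (G k) H -> (forall w, 0 <= H w) ->
  expect P (fun w => H w * V (s k.+1 w)) <=
  expect P (fun w => H w * (V (s k w) - D (s k w))).
Proof.
move=> aH H0; have aHs := finite_over_pair (sigmaG k) aH (adapted_s k).
pose Y j w := H w * V (next j (s k w)).
have -> : (fun w => H w * V (s k.+1 w)) = (fun w => Y (idx k w) w).
  by apply/funext => w; rewrite s_next.
rewrite (expect_sample hG hidx (X := Y)) => [|j]; last first.
  exact: (finite_over_comp (fun p => p.1 * V (next j p.2)) aHs).
apply: le_expect => [||w].
- apply: (filtration_measurable hG (k := k)).
  exact: (finite_over_comp (fun p => mean (fun j => p.1 * V (next j p.2))) aHs).
- apply: (filtration_measurable hG (k := k)).
  exact: (finite_over_comp (fun p => p.1 * (V p.2 - D p.2)) aHs).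
- by rewrite /Y meanZ ler_wpM2l.
Qed.

Lemma drift_ae_cvg : {ae P, forall w, cvgn (fun k => V (s k w))}.
Proof.
apply: (supermartingale_ae_cvg hG (X := fun k w => V (s k w))) => //.
  by move=> k; exact: (finite_over_comp V (adapted_s k)).
move=> k H aH H0; apply: le_trans (expect_weighted_drift aH H0) _.
have aHs := finite_over_pair (sigmaG k) aH (adapted_s k).
apply: le_expect => [||w]; last by rewrite ler_wpM2l// gerBl.
- apply: (filtration_measurable hG (k := k)).
  exact: (finite_over_comp (fun p => p.1 * (V p.2 - D p.2)) aHs).
- apply: (filtration_measurable hG (k := k)).
  exact: (finite_over_comp (fun p => p.1 * V p.2) aHs).
Qed.

Lemma sum_expect_drift_le m : \sum_(k < m) expect P (fun w => D (s k w)) <= V s0.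
Proof.
suff : \sum_(k < m) expect P (fun w => D (s k w))
    + expect P (fun w => V (s m w)) <= V s0.
  by apply: le_trans; rewrite lerDl expect_ge0.
elim: m => [|m IH].
  rewrite big_ord0 add0r (_ : (fun w => _) = (fun=> V s0)) ?expect_cst//.
  by apply/funext => w; rewrite s_init.
rewrite big_ord_recr/=; apply: le_trans IH; rewrite -addrA lerD2l.
have := @expect_weighted_drift m (fun=> 1) (finite_over_cst _ (sigmaG m)) (fun=> ler01).
under eq_fun do rewrite mul1r.
under [in X in _ <= X -> _]eq_fun do rewrite mul1r -[- D _]mulN1r.
rewrite expectD//; last exact: (simple_s (fun a => -1 * D a)).
by rewrite expectZ//; lra.
Qed.

Lemma drift_ae_cvg0 : {ae P, forall w, D (s k w) @[k --> \oo] --> (0 : R)}.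
Proof.
exact: (ae_cvg0_of_summable (X := fun k w => D (s k w)) _ _ sum_expect_drift_le).
Qed.

(** The minimum over the first [t + 1] steps is at most the mean over them, and
   the expected decreases add up to at most the initial value. *)
Lemma bigmin_expect_le (e : nat -> T -> R) (K : R) t : 0 < K ->
  (forall k, simple (e k)) -> (forall k w, K * e k w <= D (s k w)) ->
  (\big[mine/+oo]_(k < t.+1) 'E_P[e k] <= (K^-1 * t.+1%:R^-1 * V s0)%:E)%E.
Proof.
move=> K0 se eD; rewrite leNgt; apply/negP => h.
have tK : 0 < t.+1%:R :> R by [].
have ge k : (k < t.+1)%N -> V s0 / t.+1%:R < expect P (fun w => D (s k w)).
  move=> kt; have : (\big[mine/+oo]_(k < t.+1) 'E_P[e k] <= 'E_P[e k])%E.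
    exact: (bigmin_le _ (Ordinal kt)).
  move=> /(lt_le_trans h); rewrite expectE// lte_fin => lt.
  have : K * expect P (e k) <= expect P (fun w => D (s k w)).
    rewrite -expectZ//; apply: le_expect => //.
    exact: (finite_over_comp (fun r => K * r) (se k)).
  apply: lt_le_trans; rewrite -ltr_pdivrMl//.
  by move: lt; rewrite -!mulrA [V s0 * _]mulrC.
have := sum_expect_drift_le t.+1; rewrite leNgt => /negP; apply.
have -> : V s0 = \sum_(k < t.+1) V s0 / t.+1%:R.
  by rewrite sumr_const card_ord -[RHS]mulr_natr divfK// gt_eqF.
apply: ltr_sum => [|k _]; last exact: ge.
by apply/hasP; exists ord0; rewrite ?mem_index_enum.
Qed.

End SampledDrift.

(** * Euclidean topology *)

Section EuclideanTopology.
Context {R : realType} {N : nat}.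
Implicit Types (p v z : 'rV[R]_N) (C : set 'rV[R]_N) (u : nat -> 'rV[R]_N).

Lemma enorm_ball (e : R) : 0 < e ->
  exists2 r : R, 0 < r & forall v, `|v| < r -> enorm v < e.
Proof.
move=> e0; exists (e / N.+1%:R) => [|v vr]; first by rewrite divr_gt0.
rewrite -(@ltr_pXn2r _ 2)// ?nnegrE ?enorm_ge0// ?(ltW e0)// enorm_sqr.
apply: le_lt_trans (dotp_le_mxnorm v) _.
have N0 : 0 < N.+1%:R :> R by [].
have /(ler_wpM2l (ler0n _ N)) h : `|v| ^+ 2 <= (e / N.+1%:R) ^+ 2.
  by rewrite lerXn2r ?nnegrE// ?ltW// divr_gt0.
apply: le_lt_trans h _; rewrite expr_div_n mulrA ltr_pdivrMr ?exprn_gt0//.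
rewrite [ltLHS]mulrC ltr_pM2l ?exprn_gt0// -natrX ltr_nat.
by rewrite (leq_trans (ltnSn N))// expnS leq_pmulr.
Qed.

Lemma near_enorm_lt p (e : R) : 0 < e -> \forall v \near p, enorm (v - p) < e.
Proof.
move=> /enorm_ball[r r0 rP]; have : \forall v \near p, `|p - v| < r.
  exact: (@cvgr_dist_lt _ _ _ (nbhs p) _ id p cvg_id).
by apply: filterS => v; rewrite distrC => /rP.
Qed.

Lemma cvg_enormP u p :
  (forall e : R, 0 < e -> \forall k \near \oo, enorm (u k - p) < e) ->
  u k @[k --> \oo] --> p.
Proof.
move=> h; apply/cvgrPdist_lt => e /h; apply: filterS => k.
by rewrite distrC; apply: le_lt_trans (mxnorm_le_enorm _).
Qed.

Lemma continuous_sqdist z : continuous (fun v => dotp (v - z) (v - z)).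
Proof.
rewrite /dotp; apply: continuous_big => [|j _ v]; first exact: add_continuous.
have h : (w - z) ord0 j @[w --> v] --> (v - z) ord0 j.
  have -> : (fun w => (w - z) ord0 j) = (fun w => w ord0 j - z ord0 j).
    by apply/funext => w; rewrite !mxE.
  rewrite !mxE; apply: (@cvgB _ _ _ (nbhs v) _ (fun w => w ord0 j) (fun=> z ord0 j)).
    exact: coord_continuous.
  exact: cvg_cst.
exact: (@cvgM _ _ (nbhs v)).
Qed.

Lemma bounded_sqdist z (M : R) : bounded_set [set v | dotp (v - z) (v - z) <= M].
Proof.
exists (M + 1 + `|z|); split; first exact: num_real.
move=> K MK v /= vM; apply: le_trans (ltW MK).
rewrite -[v in `|v|](subrK z); apply: le_trans (ler_normD _ _) _.
rewrite lerD2r; apply: le_trans (mxnorm_le_enorm _) _.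
have := enorm_sqr (v - z); have := enorm_ge0 (v - z).
move: vM; move: (enorm _) (dotp _ _) => a b bM a0 ab.
have := sqr_ge0 (a - 2^-1); lra.
Qed.

Lemma closed_sublevel (h : 'rV[R]_N -> R) (c : R) : continuous h ->
  closed [set v | h v <= c].
Proof.
move=> ch; by apply: (@closed_comp _ _ h [set y | y <= c]).
Qed.

Lemma closest_point C z : closed C -> C !=set0 ->
  exists2 p, C p & forall v, C v -> dotp (p - z) (p - z) <= dotp (v - z) (v - z).
Proof.
move=> cC [v0 Cv0].
pose A := C `&` [set v | dotp (v - z) (v - z) <= dotp (v0 - z) (v0 - z)].
have Av0 : A v0 by split=> //=.
have cA : compact A.
  apply: bounded_closed_compact.
    have [M [Mr h]] := bounded_sqdist z (dotp (v0 - z) (v0 - z)).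
    by exists M; split=> // K MK v [_ vA]; exact: h MK v vA.
  by apply: closedI => //; exact/closed_sublevel/continuous_sqdist.
have [|p] := @compact_EVT_min _ _ (fun v => dotp (v - z) (v - z)) A
    (ex_intro _ v0 Av0) cA.
  exact/continuous_subspaceT/continuous_sqdist.
rewrite inE => -[Cp _] pmin; exists p => // v Cv.
have [h|h] := leP (dotp (v - z) (v - z)) (dotp (v0 - z) (v0 - z)).
  by apply: pmin; rewrite inE.
by apply: le_trans (ltW h); apply: pmin; rewrite inE.
Qed.

(** For every grid point [q / (m + 1)] with integer [q] that lies within
   [1 / (m + 1)] of [C], one nearby point of [C] is selected. *)
Lemma countable_dense C : C !=set0 ->
  exists D : nat -> 'rV[R]_N, (forall i, C (D i)) /\
    forall p (e : R), C p -> 0 < e -> exists i, enorm (D i - p) < e.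
Proof.
move=> [z0 Cz0].
pose grid (mq : nat * 'rV[int]_N) : 'rV[R]_N :=
  \row_j ((mq.2 ord0 j)%:~R / mq.1.+1%:R).
pose close mq : set 'rV[R]_N := [set z | C z /\ `|z - grid mq| <= mq.1.+1%:R^-1].
pose D i := if unpickle i is Some mq then xget z0 (close mq) else z0.
exists D; split=> [i|p e Cp e0].
  rewrite /D; case: unpickle => [mq|//].
  by case: xgetP => [z _ [] //|].
have [r r0 rP] := enorm_ball e0.
have [m mr] : exists m : nat, m.+1%:R^-1 < r / 2.
  have [m] := ltr_add_invr (divr_gt0 r0 (ltr0n _ 2)).
  by rewrite add0r => h; exists m.
pose q : 'rV[int]_N := \row_j Num.floor (m.+1%:R * p ord0 j).
have pq : `|p - grid (m, q)| <= m.+1%:R^-1.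
  have m0 : 0 < m.+1%:R :> R by [].
  rewrite [leLHS]/Num.norm/= mx_normrE; apply/bigmax_leP; split.
    by rewrite invr_ge0.
  move=> [i j] _; rewrite !mxE/= (ord1 i).
  set a := p ord0 j; have := floor_le (m.+1%:R * a); have := floorD1_gt (m.+1%:R * a).
  rewrite intrD; set b := (Num.floor _)%:~R => h1 h2.
  have -> : a - b / m.+1%:R = (m.+1%:R * a - b) / m.+1%:R by field; rewrite gt_eqF.
  rewrite normrM normfV (gtr0_norm m0) ler_pdivrMr// mulVf ?gt_eqF//.
  rewrite ger0_norm ?subr_ge0//; lra.
exists (pickle (m, q)); apply: rP; rewrite /D pickleK.
have [_ h] := @xgetPex _ z0 (close (m, q)) (ex_intro _ p (conj Cp pq)).
have -> : xget z0 (close (m, q)) - p =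
  (xget z0 (close (m, q)) - grid (m, q)) - (p - grid (m, q)).
  by rewrite opprB addrA subrK.
apply: le_lt_trans (ler_normB _ _) _; apply: le_lt_trans (lerD h pq) _.
by move: mr => /=; move: (m.+1%:R^-1) => a; lra.
Qed.

(** Opial's lemma: the distances of [u] to nearby points of [C] have limits, so
   a cluster point in [C] is approached by the whole sequence. *)
Lemma opial C (D : nat -> 'rV[R]_N) u :
  (forall p (e : R), C p -> 0 < e -> exists i, enorm (D i - p) < e) ->
  (forall i, cvgn (fun k => dotp (u k - D i) (u k - D i))) ->
  (forall p, cluster (u k @[k --> \oo]) p -> C p) ->
  exists2 p, C p & u k @[k --> \oo] --> p.
Proof.
move=> dense cvgD clusterC.
have [M uM] : exists M : R, \forall k \near \oo, dotp (u k - D 0%N) (u k - D 0%N) <= M.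
  have /cvg_ex[l /cvgrPdist_lt /(_ 1 ltr01) h] := cvgD 0%N; exists (l + 1).
  by apply: filterS h => k; rewrite ltr_distlC => /andP[_ /ltW].
pose A : set 'rV[R]_N := [set v | dotp (v - D 0%N) (v - D 0%N) <= M].
have cA : compact A.
  apply: bounded_closed_compact; first exact: bounded_sqdist.
  exact/closed_sublevel/continuous_sqdist.
have [p [_ clp]] := cA (u k @[k --> \oo]) _ uM.
have Cp := clusterC _ clp.
exists p => //; apply: cvg_enormP => e e0.
have e4 : 0 < e / 4 by rewrite divr_gt0.
have [i iP] := dense p _ Cp e4.
have /cvg_ex[l /cvgrPdist_lt lP] := cvgD i.
have e40 : 0 < (e / 4) ^+ 2 by rewrite exprn_gt0.
have l4 : l <= 4 * (e / 4) ^+ 2.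
  rewrite leNgt; apply/negP => l_gt.
  have lgap : 0 < l - 4 * (e / 4) ^+ 2 by rewrite subr_gt0.
  have [v [/= uv vp]] := clp
    [set v | `|l - dotp (v - D i) (v - D i)| < l - 4 * (e / 4) ^+ 2]
    _ (lP _ lgap) (near_enorm_lt p e4).
  have vi : enorm (v - D i) < e / 2.
    rewrite -(subrK p v) -addrA; apply: le_lt_trans (enormD _ _) _.
    have := iP; rewrite -enormN opprB; lra.
  have : enorm (v - D i) ^+ 2 < (e / 2) ^+ 2.
    by rewrite ltr_pXn2r// nnegrE ?enorm_ge0// ltW// divr_gt0.
  by rewrite enorm_sqr; move: uv; rewrite ltr_distlC => /andP[]; lra.
have e5 : 0 < 5 * (e / 4) ^+ 2 by rewrite mulr_gt0.
apply: filterS (lP _ e5) => k; rewrite ltr_distlC => /andP[_ h].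
have ui : enorm (u k - D i) < 3 * (e / 4).
  have e34 : 0 <= 3 * (e / 4) by lra.
  rewrite -(@ltr_pXn2r _ 2)// ?nnegrE ?enorm_ge0//.
  by rewrite enorm_sqr; lra.
by rewrite -(subrK (D i) (u k)) -addrA; apply: le_lt_trans (enormD _ _) _; lra.
Qed.

End EuclideanTopology.

(** * Convergence along one trajectory *)

(** The hypotheses on a trajectory are those that hold almost surely. *)

Section Trajectory.
Context {R : realType} {n N : nat}.
Variables (L lambda theta : R) (f : 'I_n -> 'rV[R]_N -> R).
Hypotheses (n0 : (0 < n)%N) (L0 : 0 < L) (hf : forall i, convex_smooth L (f i)).

Let state := ('rV[R]_N * ('I_n -> 'rV[R]_N))%type.
Let F := average f.
Let V := lyapunov L lambda theta f.
Let m := n%:R - theta.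

Lemma closed_argmin : closed (argmin F).
Proof.
have [[z0 z0min]|none] := pselect (argmin F !=set0).
  have -> : argmin F = [set v | F v <= F z0].
    apply/seteqP; split=> v /= h; first exact: h.
    by move=> w; apply: le_trans h (z0min w).
  by apply: closed_sublevel; exact: continuous_average hf.
have -> : argmin F = set0 by rewrite -subset0 => v vmin; apply: none; exists v.
exact: closed0.
Qed.

Lemma cvg_sqdist (u : nat -> 'rV[R]_N) p :
  dotp (u k - p) (u k - p) @[k --> \oo] --> (0 : R) -> u k @[k --> \oo] --> p.
Proof.
move=> h; apply: cvg_enormP => e e0.
have e2 : 0 < e ^+ 2 by rewrite exprn_gt0.
move/cvgrPdist_lt : h => /(_ _ e2); apply: filterS => k.
rewrite sub0r normrN ger0_norm ?dotp_ge0// -enorm_sqr.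
by rewrite ltr_pXn2r// nnegrE ?enorm_ge0// ltW.
Qed.

Variables (s : nat -> state) (z : 'rV[R]_N) (D : nat -> 'rV[R]_N).
Hypotheses (zmin : argmin F z) (Dmin : forall i, argmin F (D i))
  (dense : forall p (e : R), argmin F p -> 0 < e -> exists i, enorm (D i - p) < e).
Hypotheses
  (grad0 : gradient_error f z (s k) @[k --> \oo] --> (0 : R))
  (mem0 : memory_error f z (s k) @[k --> \oo] --> (0 : R))
  (val0 : F (s k).1 - F z @[k --> \oo] --> (0 : R))
  (lyapD : forall i, cvgn (fun k => V (D i) (s k))).

Let A k := mean_gradient f (s k).1.
Let B k := vmean (s k).2.

Let sqrA : dotp (A k) (A k) @[k --> \oo] --> (0 : R).
Proof.
apply: (@squeeze_cvgr _ _ _ _ (fun=> 0) (fun k => n%:R^-1 * gradient_error f z (s k))).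
- apply: nearW => k; rewrite dotp_ge0/=.
  have := sqr_mean_gradient_le n0 L0 hf (s k).1 (s k).2 zmin.
  by rewrite /A; case: (s k).
- exact: cvg_cst.
- by rewrite -[X in _ --> X](mulr0 n%:R^-1); exact: cvgMl_tmp.
Qed.

Let sqrB : dotp (B k) (B k) @[k --> \oo] --> (0 : R).
Proof.
apply: (@squeeze_cvgr _ _ _ _ (fun=> 0) (fun k => n%:R^-1 * memory_error f z (s k))).
- apply: nearW => k; rewrite dotp_ge0/=.
  have := sqr_vmean_memory_le n0 L0 hf (s k).1 (s k).2 zmin.
  by rewrite /B; case: (s k).
- exact: cvg_cst.
- by rewrite -[X in _ --> X](mulr0 n%:R^-1); exact: cvgMl_tmp.
Qed.

Let B0 : B k @[k --> \oo] --> (0 : 'rV[R]_N).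
Proof. by apply: cvg_sqdist; under eq_cvg do rewrite subr0; exact: sqrB. Qed.

(** The descent lemma controls the value at any point differing from the
   iterate by a fixed multiple of the vanishing memory average. *)
Let valB t : F ((s k).1 + t *: B k) - F z @[k --> \oo] --> (0 : R).
Proof.
pose b k := (F (s k).1 - F z) + (2^-1 * dotp (A k) (A k)
   + (2^-1 + L / 2) * t ^+ 2 * dotp (B k) (B k)).
apply: (@squeeze_cvgr _ _ _ _ (fun=> 0) b).
- apply: nearW => k; rewrite subr_ge0 zmin/= /b.
  have := average_descent n0 L0 hf (s k).1 (t *: B k); rewrite -/F -/(A k).
  have := @dotp_young _ _ 1 (A k) (t *: B k) ltr01.
  move: (A k) (B k) => a c; rewrite invr1 !mul1r !(dotpZl, dotpZr).
  by move: (dotp a a) (dotp a c) (dotp c c) => aa ac cc; lra.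
- exact: cvg_cst.
- rewrite /b -[X in _ --> X](addr0 0); apply: cvgD => //.
  rewrite -[X in _ --> X](addr0 0); apply: cvgD.
    by rewrite -[X in _ --> X](mulr0 2^-1); exact: cvgMl_tmp.
  by rewrite -[X in _ --> X](mulr0 ((2^-1 + L / 2) * t ^+ 2)); exact: cvgMl_tmp.
Qed.

(** The Lyapunov values differ from the squared distances of the shifted point by
   terms with a limit, which is what Opial's lemma needs. *)
Lemma trajectory_cvg : exists2 p, argmin F p &
  (s k).1 @[k --> \oo] --> p /\
  forall i, (s k).2 i @[k --> \oo] --> gradient (f i) p.
Proof.
pose u k := shifted_point lambda theta (s k).
have uE k : u k = (s k).1 + (- (lambda * m)) *: B k by rewrite scaleNr.
have distD i : cvgn (fun k => dotp (u k - D i) (u k - D i)).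
  have -> : (fun k => dotp (u k - D i) (u k - D i)) = (fun k => V (D i) (s k)
      - lambda / L * memory_error f z (s k)
      - 2 * lambda * m * (F ((s k).1 + lambda *: B k) - F z)).
    apply/funext => k; rewrite /V /lyapunov -/(u k) -/F -/m.
    have -> : memory_error f (D i) (s k) = memory_error f z (s k).
      by apply: eq_bigr => j _; rewrite (argmin_gradient_eq n0 L0 hf j (Dmin i) zmin).
    have -> : F (D i) = F z := argmin_average_eq (Dmin i) zmin.
    by rewrite /probe_point -/(B k); ring.
  apply: is_cvgB; first apply: is_cvgB => //.
    by apply: is_cvgMl_tmp; apply/cvg_ex; exists 0.
  by apply: is_cvgMl_tmp; apply/cvg_ex; exists 0; exact: valB.
have cluster_min p : cluster (u k @[k --> \oo]) p -> argmin F p.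
  move=> clp; suff pz : F p <= F z by move=> v; apply: le_trans pz (zmin v).
  rewrite leNgt; apply/negP => zp.
  have h1 : 0 < (F p - F z) / 2 by rewrite divr_gt0// subr_gt0.
  have near_p : \forall v \near p, `|F p - F v| < (F p - F z) / 2.
    have cF : continuous F := continuous_average hf.
    by have /cvgrPdist_lt := cF p; apply.
  have near_u : (u k @[k --> \oo]) [set v | F v - F z < (F p - F z) / 2].
    have := valB (- (lambda * m)); move/cvgrPdist_lt => /(_ _ h1).
    apply: filterS => k; rewrite -uE sub0r normrN /=.
    by apply: le_lt_trans; exact: ler_norm.
  have [v [/= vu]] := clp _ _ near_u near_p.
  by rewrite ltr_distlC => /andP[]; lra.
have [p pmin up] := opial dense distD cluster_min.
exists p => //; split=> [|i].
  have -> : (fun k => (s k).1) = (fun k => u k + (lambda * m) *: B k).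
    by apply/funext => k; rewrite uE -addrA -scalerDl addNr scale0r addr0.
  rewrite -[X in _ --> X]addr0; apply: cvgD => //.
  by rewrite -[X in _ --> X](scaler0 _ (lambda * m)); exact: cvgZl_tmp.
rewrite (argmin_gradient_eq n0 L0 hf i pmin zmin); apply: cvg_sqdist.
apply: (@squeeze_cvgr _ _ _ _ (fun=> 0) (fun k => memory_error f z (s k))) => //.
- apply: nearW => k; rewrite dotp_ge0/= /memory_error (bigD1 i)//= lerDl.
  by apply: sumr_ge0 => j _; exact: dotp_ge0.
- exact: cvg_cst.
Qed.

End Trajectory.

(** * The theorem *)

Section StateProcess.
Context {R : realType} {n N : nat} {d : measure_display} {T : measurableType d}.
Implicit Types (G : set (set T)) (a : 'rV[R]_N).

Lemma svag_finite_range (Rop : 'I_n -> 'rV[R]_N -> 'rV[R]_N) lambda theta x0 y0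
    (idx : nat -> T -> 'I_n) k :
  exists (I : finType) (p : I -> _),
    forall w, exists i, svag Rop lambda theta x0 y0 (idx ^~ w) k = p i.
Proof.
elim: k => [|k [I [p pP]]]; first by exists unit, (fun=> (x0, y0)) => w; exists tt.
exists ('I_n * I)%type, (fun ji => svag_step Rop lambda theta ji.1 (p ji.2)) => w.
by have [i Ei] := pP w; exists (idx k w, i); rewrite /= Ei.
Qed.

Lemma measurable_vec_eq G (X : T -> 'rV[R]_N) a : sigma_algebra setT G ->
  measurable_vec G X -> G (X @^-1` [set a]).
Proof.
move=> sG GX; have -> : X @^-1` [set a] =
   [set w | forall j, ((fun w => X w ord0 j) @^-1` [set a ord0 j]) w].
  apply/seteqP; split=> w /=; first by move=> -> j.
  by move=> h; apply/rowP => j; exact: h.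
by apply: sigma_algebra_fin_bigcap => // j; apply: GX; exact: measurable_set1.
Qed.

End StateProcess.

Lemma measurable_vec_cvg (R : realType) (N : nat) d (T : measurableType d)
    (X : nat -> T -> 'rV[R]_N) (Y : T -> 'rV[R]_N) :
  (forall k, measurable_vec measurable (X k)) ->
  (forall w, X k w @[k --> \oo] --> Y w) -> measurable_vec measurable Y.
Proof.
move=> mX XY j B mB.
have mY : measurable_fun setT (fun w => Y w ord0 j).
  apply: (@measurable_fun_cvg _ _ _ _ (fun k w => X k w ord0 j)).
    by move=> k _ C mC; rewrite setTI; exact: mX.
  move=> w _.
  apply: (@cvg_comp _ _ _ (fun k => X k w) (fun v => v ord0 j) _ _ _ (XY w)).
  exact: (@coord_continuous R 1 N ord0 j (Y w)).
by rewrite -[X in measurable X]setTI; exact: mY.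
Qed.

Lemma measurable_vec_patch (R : realType) (N : nat) d (T : measurableType d)
    (X : T -> 'rV[R]_N) (A : set T) (a : 'rV[R]_N) :
  measurable A -> measurable_vec measurable X ->
  measurable_vec measurable (fun w => if w \in A then a else X w).
Proof.
move=> mA mX j B mB.
have -> : (fun w => (if w \in A then a else X w) ord0 j) @^-1` B =
   (A `&` [set w | B (a ord0 j)]) `|` (~` A `&` (fun w => X w ord0 j) @^-1` B).
  apply/seteqP; split=> w /=.
    by case: ifPn => [/set_mem|]; [left|rewrite notin_setE; right].
  by move=> [[Aw Ba]|[Aw Xw]]; [rewrite mem_set|rewrite memNset].
apply: measurableU; apply: measurableI => //; [|exact: measurableC|exact: mX].
have [Ba|nBa] := pselect (B (a ord0 j)).
  by have -> : [set _ : T | B (a ord0 j)] = setT by apply/seteqP; split.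
by have -> : [set _ : T | B (a ord0 j)] = set0 by apply/seteqP; split=> // w /nBa.
Qed.

Theorem theorem3p2 (R : realType) (n N : nat) (hn : (1 <= n)%N) (hN : (1 <= N)%N)
  (L : R) (hL : 0 < L)
  (f : 'I_n -> 'rV[R]_N -> R) (hf : forall i, convex_smooth L (f i))
  (hX : argmin (average f) !=set0)
  (lambda theta : R) (hlambda : 0 < lambda) (htheta : 0 <= theta <= n%:R)
  (x0 : 'rV[R]_N) (y0 : 'I_n -> 'rV[R]_N)
  (d : measure_display) (T : measurableType d) (P : probability T R)
  (G : nat -> set (set T)) (hG : filtration G)
  (idx : nat -> T -> 'I_n) (hidx : uniform_sampling P G idx)
  (x : nat -> T -> 'rV[R]_N) (y : 'I_n -> nat -> T -> 'rV[R]_N)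
  (hx : forall k w, x k w =
    (svag (fun i => gradient (f i)) lambda theta x0 y0 (fun m => idx m w) k).1)
  (hy : forall i k w, y i k w =
    (svag (fun i => gradient (f i)) lambda theta x0 y0 (fun m => idx m w) k).2 i)
  (hxG : forall k, measurable_vec (G k) (x k))
  (hyG : forall i k, measurable_vec (G k) (y i k))
  (hstep : 1 / L * (1 / svag_const n theta) > lambda) :
  (exists xlim : T -> 'rV[R]_N,
    [/\ measurable_vec measurable xlim,
        forall w, argmin (average f) (xlim w) &
        {ae P, forall w,
          x k w @[k --> \oo] --> xlim w /\
          forall i, y i k w @[k --> \oo] --> gradient (f i) (xlim w)}]) /\
  (forall xstar, argmin (average f) xstar ->
    exists CR : R,
      is_min [set CR_fun f L lambda theta x0 y0 xstar z
             | z in argmin (average f)] CR /\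
      forall (i : 'I_n) (t : nat),
        [/\ (\big[mine/+oo]_(k < t.+1)
              'E_P[(fun w => enorm (gradient (f i) (x k w)
                                    - gradient (f i) xstar) ^+ 2)%R]
             <= (n%:R / (lambda * (L^-1 - lambda * svag_const n theta))
                 * (1 / t.+1%:R)
                 * (CR + CF f lambda theta x0 y0 xstar))%:E)%E,
            (\big[mine/+oo]_(k < t.+1)
              'E_P[(fun w => enorm (y i k w - gradient (f i) xstar) ^+ 2)%R]
             <= (n%:R / (lambda * (L^-1 - lambda * svag_const n theta))
                 * (1 / t.+1%:R)
                 * (CR + CF f lambda theta x0 y0 xstar))%:E)%E &
            (\big[mine/+oo]_(k < t.+1)
              'E_P[(fun w => average f (x k w) - average f xstar)%R]
             <= (1 / (lambda * (1 - L * lambda * svag_const n theta))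
                 * (1 / t.+1%:R)
                 * (CR + CF f lambda theta x0 y0 xstar))%:E)%E]).
Proof.
move: htheta => /andP[_ theta_n].
set F := average f in hX *.
have c2 := svag_const_ge2 hn theta_n; set c := svag_const n theta in c2 hstep *.
have c0 : 0 < c by apply: lt_le_trans c2.
have step1 : lambda * L * c < 1.
  rewrite -mulrA -ltr_pdivlMr ?mulr_gt0// div1r invfM.
  by move: hstep; rewrite !div1r.
have nn : 0 < n%:R :> R by rewrite ltr0n.
have nV : 0 < n%:R^-1 :> R by rewrite invr_gt0.
have gap0 : 0 < L^-1 - lambda * c.
  rewrite subr_gt0 -[ltRHS]mulr1 ltr_pdivlMl//.
  by move: step1; rewrite mulrA [L * _]mulrC.
have K0 : 0 < lambda * (L^-1 - lambda * c) by rewrite mulr_gt0.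
have K0' : 0 < lambda * (1 - L * lambda * c).
  by rewrite mulr_gt0// subr_gt0 [L * _]mulrC.
pose Rop i := gradient (f i).
pose next := svag_step Rop lambda theta.
pose s k w := svag Rop lambda theta x0 y0 (idx ^~ w) k.
have xE : x = (fun k w => (s k w).1) by apply/funext => k; apply/funext => w; exact: hx.
have yE : y = (fun i k w => (s k w).2 i).
  by apply/funext => i; apply/funext => k; apply/funext => w; exact: hy.
have sigmaG k : sigma_algebra setT (G k) by case: hG.
have adapted_s k : finite_over (G k) (s k).
  have [I [p pP]] := svag_finite_range Rop lambda theta x0 y0 idx k.
  apply: (finite_over_of_range (p := p) _ _ _ (x0, y0)) => // a.
  have -> : s k @^-1` [set a] = (x k @^-1` [set a.1]) `&`
      [set w | forall i, (y i k @^-1` [set a.2 i]) w].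
    rewrite xE yE; apply/seteqP; split=> w /=; first by move=> ->.
    move=> [h1 h2]; rewrite (surjective_pairing (s k w)) h1 (surjective_pairing a).
    by congr (_, _); apply/funext.
  apply: sigma_algebra_setI => //; first exact: measurable_vec_eq.
  by apply: sigma_algebra_fin_bigcap => // i; exact: measurable_vec_eq.
have simple_s (h : _ -> R) k : simple (fun w => h (s k w)).
  exact: (finite_over_comp h (filtration_measurable hG (adapted_s k))).
pose V := lyapunov L lambda theta f.
pose D1 z a := lambda * (L^-1 - lambda * c) *
  (n%:R^-1 * (gradient_error f z a + memory_error f z a)).
pose D2 z (a : 'rV[R]_N * ('I_n -> 'rV[R]_N)) :=
  lambda * (1 - L * lambda * c) * (F a.1 - F z).
have ge0 z a : 0 <= gradient_error f z a.
  by apply: sumr_ge0 => i _; exact: dotp_ge0.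
have me0 z a : 0 <= memory_error f z a.
  by apply: sumr_ge0 => i _; exact: dotp_ge0.
have D1_ge0 z a : 0 <= D1 z a.
  apply: mulr_ge0; first exact: ltW.
  by apply: mulr_ge0; [exact: ltW|exact: addr_ge0].
have D2_ge0 z a : argmin F z -> 0 <= D2 z a.
  by move=> zmin; apply: mulr_ge0; [exact: ltW|rewrite subr_ge0].
have V_ge0 z a : argmin F z -> 0 <= V z a.
  exact: lyapunov_ge0.
have drift1 z a : argmin F z -> mean (fun j => V z (next j a)) <= V z a - D1 z a.
  by move=> zmin; case: a => xa ya; exact: lyapunov_drift.
have drift2 z a : argmin F z -> mean (fun j => V z (next j a)) <= V z a - D2 z a.
  by move=> zmin; case: a => xa ya; exact: lyapunov_drift_value.
split.
- have [zs zsmin] := hX.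
  have [D [Dmin dense]] := countable_dense hX.
  have cvg1 := drift_ae_cvg0 (s := s) (next := next) hG hidx
    (fun=> erefl) (fun _ _ => erefl) adapted_s (V_ge0 zs ^~ zsmin)
    (D1_ge0 zs) (drift1 zs ^~ zsmin).
  have cvg2 := drift_ae_cvg0 (s := s) (next := next) hG hidx
    (fun=> erefl) (fun _ _ => erefl) adapted_s (V_ge0 zs ^~ zsmin)
    (D2_ge0 zs ^~ zsmin) (drift2 zs ^~ zsmin).
  have cvgV : {ae P, forall w i, cvgn (fun k => V (D i) (s k w))}.
    apply: ae_foralln => i.
    exact: (drift_ae_cvg (s := s) (next := next) hG hidx (fun _ _ => erefl) adapted_s
      (V_ge0 (D i) ^~ (Dmin i)) (D1_ge0 (D i)) (drift1 (D i) ^~ (Dmin i))).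
  have good : {ae P, forall w, exists2 p, argmin F p &
      (s k w).1 @[k --> \oo] --> p /\
      forall i, (s k w).2 i @[k --> \oo] --> gradient (f i) p}.
    apply: filterS3 cvg1 cvg2 cvgV => w w1 w2 wV.
    (* Both errors are dominated by a multiple of the first decrease. *)
    pose K := lambda * (L^-1 - lambda * c) * n%:R^-1.
    have Kp : 0 < K by rewrite mulr_gt0.
    have scaled0 (h : _ -> R) (q : R) (e : nat -> R) : (forall a, 0 <= h a) -> 0 < q ->
        (forall k, q * h (s k w) <= e k) -> e k @[k --> \oo] --> (0 : R) ->
        h (s k w) @[k --> \oo] --> (0 : R).
      move=> h0 q0 he e0.
      apply: (@squeeze_cvgr _ _ _ _ (fun=> 0) (fun k => q^-1 * e k)).
      - by apply: nearW => k; rewrite h0 ler_pdivlMl// he.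
      - exact: cvg_cst.
      - by rewrite -[X in _ --> X](mulr0 q^-1); exact: cvgMl_tmp.
    apply: (trajectory_cvg hn hL hf zsmin Dmin dense _ _ _ wV).
    - apply: (scaled0 (gradient_error f zs) K _ _ _ _ w1) => // k.
      by rewrite /K /D1 -!mulrA !ler_wpM2l ?(ltW hlambda) ?(ltW gap0) ?(ltW nV)// lerDl.
    - apply: (scaled0 (memory_error f zs) K _ _ _ _ w1) => // k.
      by rewrite /K /D1 -!mulrA !ler_wpM2l ?(ltW hlambda) ?(ltW gap0) ?(ltW nV)// lerDr.
    - apply: (scaled0 (fun a => F a.1 - F zs)
        (lambda * (1 - L * lambda * c)) _ _ _ _ w2) => //.
      by move=> a; rewrite subr_ge0.
  have [A [mA PA badA]] := good.
  have /choice[xlim hlim] : forall w, exists p, argmin F p /\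
      if w \in A then p = zs else (s k w).1 @[k --> \oo] --> p /\
      forall i, (s k w).2 i @[k --> \oo] --> gradient (f i) p.
    move=> w; have [_|] := boolP (w \in A); first by exists zs.
    rewrite notin_setE => nA; apply: contrapT => none; apply/nA/badA => -[p pmin pl].
    by apply: none; exists p.
  (* On the null set A the iterates are replaced by zs, so that xlim is everywhere
     a limit of random vectors. *)
  exists xlim; split.
  + pose X k w := if w \in A then zs else x k w.
    apply: (@measurable_vec_cvg _ _ _ _ X) => [k|w].
      apply: measurable_vec_patch => // j B mB; case: hG => _ Gm _.
      by apply: (Gm k); exact: hxG.
    have [_] := hlim w; rewrite /X xE; case: ifPn => [_ ->|_ []//].
    exact: cvg_cst.
  + by move=> w; have [] := hlim w.
  + exists A; split=> // w nw; apply: contrapT => nA; apply: nw => /=.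
    have [_] := hlim w; rewrite memNset// xE yE => -[h1 h2]; split=> // i.
- move=> xs xsmin.
  pose u0 := shifted_point lambda theta (x0, y0).
  have [p pmin closest] := closest_point u0 (closed_argmin hf) hX.
  have CRE v : CR_fun f L lambda theta x0 y0 xs v =
      dotp (v - u0) (v - u0) + lambda / L * memory_error f xs (x0, y0).
    rewrite /CR_fun /memory_error !enorm_sqr -/(vmean y0).
    under eq_bigr do rewrite enorm_sqr.
    have -> : v - u0 = (lambda * (n%:R - theta)) *: vmean y0 - (x0 - v).
      by rewrite /u0 /shifted_point/=; apply/rowP => j; rewrite !mxE; ring.
    move: (vmean y0) (x0 - v) (\sum_i _) => b a q.
    rewrite !(dotpDl, dotpDr, dotpNl, dotpNr, dotpZl, dotpZr) (dotpC b a); ring.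
  have VE : V p (x0, y0) =
      CR_fun f L lambda theta x0 y0 xs p + CF f lambda theta x0 y0 xs.
    rewrite CRE /V /lyapunov /CF -/u0.
    have -> : memory_error f p (x0, y0) = memory_error f xs (x0, y0).
      by apply: eq_bigr => j _; rewrite (argmin_gradient_eq hn hL hf j pmin xsmin).
    rewrite (argmin_average_eq pmin xsmin) /probe_point/= /vmean scalerA.
    have -> : p - u0 = - (u0 - p) by rewrite [RHS]opprB.
    by rewrite dotpNl dotpNr opprK.
  exists (CR_fun f L lambda theta x0 y0 xs p); split.
    split; first by exists p.
    by move=> _ [v vmin <-]; rewrite !CRE lerD2r; exact: closest.
  move=> i t; rewrite -VE xE yE.
  have xsp j : gradient (f j) xs = gradient (f j) p.
    exact: (argmin_gradient_eq hn hL hf j xsmin pmin).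
  have Kn : 0 < lambda * (L^-1 - lambda * c) * n%:R^-1 by rewrite mulr_gt0.
  have bound1 := bigmin_expect_le (P := P) (s := s) (next := next) hG hidx
    (fun=> erefl) (fun _ _ => erefl) adapted_s
    (V_ge0 p ^~ pmin) (drift1 p ^~ pmin) t Kn.
  have bound2 := bigmin_expect_le (P := P) (s := s) (next := next) hG hidx
    (fun=> erefl) (fun _ _ => erefl) adapted_s
    (V_ge0 p ^~ pmin) (drift2 p ^~ pmin) t K0'.
  have E1 : n%:R / (lambda * (L^-1 - lambda * c)) * (1 / t.+1%:R) =
      (lambda * (L^-1 - lambda * c) * n%:R^-1)^-1 * t.+1%:R^-1.
    by rewrite div1r [in RHS]invfM invrK [n%:R * _]mulrC.
  have E2 : 1 / (lambda * (1 - L * lambda * c)) * (1 / t.+1%:R) =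
      (lambda * (1 - L * lambda * c))^-1 * t.+1%:R^-1 by rewrite !div1r.
  rewrite E1 E2; split.
  + apply: (bound1 (fun k w =>
      enorm (gradient (f i) (s k w).1 - gradient (f i) xs) ^+ 2)) => [k|k w].
      exact: (simple_s (fun a => enorm (gradient (f i) a.1 - gradient (f i) xs) ^+ 2)).
    rewrite enorm_sqr xsp /D1 -!mulrA !ler_wpM2l ?(ltW hlambda) ?(ltW gap0) ?(ltW nV)//.
    rewrite /gradient_error (bigD1 i)//= -addrA lerDl addr_ge0//.
    by apply: sumr_ge0 => j _; exact: dotp_ge0.
  + apply: (bound1 (fun k w =>
      enorm ((s k w).2 i - gradient (f i) xs) ^+ 2)) => [k|k w].
      exact: (simple_s (fun a => enorm (a.2 i - gradient (f i) xs) ^+ 2)).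
    rewrite enorm_sqr xsp /D1 -!mulrA !ler_wpM2l ?(ltW hlambda) ?(ltW gap0) ?(ltW nV)//.
    rewrite /memory_error (bigD1 i)//= addrCA lerDl addr_ge0//.
    by apply: sumr_ge0 => j _; exact: dotp_ge0.
  + apply: (bound2 (fun k w => F (s k w).1 - F xs)) => [k|k w].
      exact: (simple_s (fun a => average f a.1 - average f xs)).
    by have Fp : F p = F xs := argmin_average_eq pmin xsmin; rewrite /D2 Fp.
Qed.
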